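(* Let $\tau(t)$ be an arbitrary KdV tau function. Then for all nonzero $z_1,z_2,z_3,z_4\in\mathbb C$ the following seventh-order identity holds: $$(z_4^{-1}-z_3^{-1})\,\tau(t+[z_1])\tau(t-[z_1])\tau(t+[z_2])\tau(t-[z_2])\bigl[\tau(t+[z_3])\tau(t+[z_4])\tau(t-[z_3]-[z_4])-\tau(t-[z_3])\tau(t-[z_4])\tau(t+[z_3]+[z_4])\bigr]$$ $$+(z_2^{-1}-z_1^{-1})\,\tau(t+[z_3])\tau(t-[z_3])\tau(t+[z_4])\tau(t-[z_4])\bigl[\tau(t+[z_1])\tau(t+[z_2])\tau(t-[z_1]-[z_2])-\tau(t-[z_1])\tau(t-[z_2])\tau(t+[z_1]+[z_2])\bigr]$$ $$=(z_2^{-1}-z_3^{-1})\,\tau(t+[z_1])\tau(t-[z_1])\tau(t+[z_4])\tau(t-[z_4])\bigl[\tau(t+[z_2])\tau(t+[z_3])\tau(t-[z_2]-[z_3])-\tau(t-[z_2])\tau(t-[z_3])\tau(t+[z_2]+[z_3])\bigr]$$ $$+(z_4^{-1}-z_1^{-1})\,\tau(t+[z_2])\tau(t-[z_2])\tau(t+[z_3])\tau(t-[z_3])\bigl[\tau(t+[z_1])\tau(t+[z_4])\tau(t-[z_1]-[z_4])-\tau(t-[z_1])\tau(t-[z_4])\tau(t+[z_1]+[z_4])\bigr].$$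
   Context: Notation: $t=(t_1,t_2,t_3,\dots)\in\mathbb C^\infty$, $x\equiv t_1$. For $z\in\mathbb C$, $[z]:=(z,z^2/2,z^3/3,\dots)\in\mathbb C^\infty$, so $\tau(t\pm[z])=\tau(t_1\pm z,t_2\pm z^2/2,t_3\pm z^3/3,\dots)$. A KdV tau function is a (not identically zero) tau function of the Kadomtsev–Petviashvili (KP) hierarchy with $\partial_{t_{2k}}\tau=0$ for $k=1,2,3,\dots$; consequently $\tau(t-[z])=\tau(t+[-z])$ for all $z$. Here a KP tau function has its standard meaning (the Hirota bilinear identity: the coefficient of $z^{-1}$ in $\exp(\sum_{k\ge1}(t_k-t_k')z^k)\,\tau(t-[z^{-1}])\,\tau(t'+[z^{-1}])$ vanishes for all $t,t'$). It is a known fact that every KP tau function satisfies the Fay identity: for all $z_0,z_1,z_2,z_3$, $$(z_0-z_1)(z_2-z_3)\tau(t+[z_0]+[z_1])\tau(t+[z_2]+[z_3])+(z_0-z_2)(z_3-z_1)\tau(t+[z_0]+[z_2])\tau(t+[z_3]+[z_1])+(z_0-z_3)(z_1-z_2)\tau(t+[z_0]+[z_3])\tau(t+[z_1]+[z_2])=0.$$ Conventions: $\tau$ is regular enough (e.g. polynomial, analytic, or a formal power series with the $z$'s treated accordingly) that the partial derivatives exist and shifts are differentiated by the chain rule $\partial_z\,\tau(t+[z])=\sum_{k\ge1}z^{k-1}(\partial_{t_k}\tau)(t+[z])$. Identities are understood where the expressions are defined. *)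

(* Defs.v *)
From HB Require Import structures.
From mathcomp Require Import all_boot all_order all_algebra.
From mathcomp Require Import finmap.
From mathcomp Require Import monalg.
From mathcomp Require Import mathcomp_extra boolp classical_sets functions.
From mathcomp Require Import cardinality fsbigop reals complex.

Set Implicit Arguments.
Unset Strict Implicit.
Unset Printing Implicit Defensive.

Import GRing.Theory Num.Theory.

Local Open Scope ring_scope.

(* K[[x_i, i in I]] for an arbitrary, possibly infinite, set I of variables:
   all families of coefficients indexed by the finitely supported exponents. *)
Record fps (I : choiceType) (K : Type) := FPS { fpscoef :> {cmonom I} -> K }.

Section FpsChoice.
Context (I : choiceType) (K : Type).

HB.instance Definition _ := gen_eqMixin (fps I K).
HB.instance Definition _ := gen_choiceMixin (fps I K).

Lemma fpsP (f g : fps I K) : f =1 g -> f = g.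
Proof. by case: f g => [f] [g] /= /funext ->. Qed.

End FpsChoice.

Section CmonomDivisors.
Context (I : choiceType).
Implicit Types m a b : {cmonom I}.

Lemma mulcm_factors_finite m :
  finite_set [set p : {cmonom I} * {cmonom I} | mmul p.1 p.2 = m]%classic.
Proof.
pose T := {ffun finsupp m -> 'I_(mdeg m).+1}.
pose h (f : T) : {cmonom I} := [cmonom (f i : nat) | i : finsupp m]%M.
pose S := (h @` [set: T])%classic.
have finS : finite_set S by exact/finite_image/finite_finset.
have inS a b : mmul a b = m -> S a.
  move=> abm; have le_am i : (a i <= m i)%N by rewrite -abm cmM leq_addr.
  exists [ffun i => inord (a (val i))] => //.
  apply/eqP/cmP => i; rewrite cmE fsfun_ffun; case: insubP => [u _ <-|].
    rewrite /= ffunE inordK // ltnS (leq_trans (le_am _)) //.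
    by rewrite mdegE (big_fsetD1 (val u)) ?leq_addr //=; exact: valP.
  rewrite /= memNfinsupp => /eqP mi0; move: (le_am i); rewrite mi0 leqn0.
  by move/eqP.
apply: (sub_finite_set _ (finite_setX finS finS)) => -[a b] /= abm; split.
  exact: inS abm.
by apply: (inS b a); rewrite mulmC.
Qed.

Definition mdivisors m : {fset {cmonom I}} :=
  fset_set (fst @` [set p : {cmonom I} * {cmonom I} | mmul p.1 p.2 = m])%classic.

Lemma mdivisorsP m a : reflect (exists b, mmul a b = m) (a \in mdivisors m).
Proof.
rewrite in_fset_set; last exact/finite_image/mulcm_factors_finite.
apply: (iffP idP) => [/set_mem[[x y] /= xym <-]|[b abm]]; first by exists y.
by apply/mem_set; exists (a, b).
Qed.

End CmonomDivisors.

Section FpsRing.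
Context (I : choiceType) (K : comNzRingType).
Implicit Types (f g h : fps I K) (m a b : {cmonom I}) (c : K).

Definition fps0 : fps I K := FPS (fun=> 0).
Definition fpsN f : fps I K := FPS (fun m => - f m).
Definition fpsD f g : fps I K := FPS (fun m => f m + g m).
Definition fpsC c : fps I K := FPS (fun m => if m == mone then c else 0).
Definition fpsZ c f : fps I K := FPS (fun m => c * f m).
Definition fpsM f g : fps I K :=
  FPS (fun m => \sum_(p \in [set p : {cmonom I} * {cmonom I} |
                              mmul p.1 p.2 = m]%classic) f p.1 * g p.2).

Fact fpsDA : associative fpsD.
Proof. by move=> f g h; apply/fpsP => m /=; rewrite addrA. Qed.
Fact fpsDC : commutative fpsD.
Proof. by move=> f g; apply/fpsP => m /=; rewrite addrC. Qed.
Fact fps0D : left_id fps0 fpsD.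
Proof. by move=> f; apply/fpsP => m /=; rewrite add0r. Qed.
Fact fpsND : left_inverse fps0 fpsN fpsD.
Proof. by move=> f; apply/fpsP => m /=; rewrite addNr. Qed.

HB.instance Definition _ :=
  GRing.isZmodule.Build (fps I K) fpsDA fpsDC fps0D fpsND.

Lemma fpsM_fset f g m (A : {fset {cmonom I}}) :
  (forall a b, mmul a b = m -> (a \in A) && (b \in A)) ->
  fpsM f g m = \sum_(a <- A) \sum_(b <- A) if mmul a b == m then f a * g b else 0.
Proof.
move=> mA; rewrite /=.
have -> : [set p : {cmonom I} * {cmonom I} | mmul p.1 p.2 = m]%classic
        = [set` (fun p : {cmonom I} * {cmonom I} => mmul p.1 p.2 == m)]%classic.
  by apply/seteqP; split => p /= /eqP.
rewrite -(@bigfs _ _ _ _ [seq (a, b) | a <- A, b <- A]).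
- rewrite big_mkcond big_allpairs /=; apply: eq_bigr => a _.
  by apply: eq_bigr => b _.
- by apply: allpairs_uniq => [||[? ?] [? ?]]; rewrite ?fset_uniq.
- by move=> [a b] /= /eqP /mA /andP[aA bA]; rewrite allpairs_f.
Qed.

Lemma mdivisors_factors m a b : mmul a b = m ->
  (a \in mdivisors m) && (b \in mdivisors m).
Proof.
by move=> abm; apply/andP; split; apply/mdivisorsP;
  [exists b | exists a; rewrite mulmC].
Qed.

Let fpsME f g m := fpsM_fset f g (@mdivisors_factors m).

Fact fpsMC : commutative fpsM.
Proof.
move=> f g; apply/fpsP => m; rewrite !fpsME exchange_big /=.
by apply: eq_bigr => b _; apply: eq_bigr => a _; rewrite mulmC mulrC.
Qed.

Let fpsM3 f g h m : fpsM f (fpsM g h) m =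
  \sum_(a <- mdivisors m) \sum_(b <- mdivisors m) \sum_(d <- mdivisors m)
    if mmul a (mmul b d) == m then f a * (g b * h d) else 0.
Proof.
rewrite fpsME; apply: eq_big_seq => a _; set D := mdivisors m.
have sub p : mmul a p = m -> forall b d, mmul b d = p -> (b \in D) && (d \in D).
  move=> apm b d bcp; apply/andP; split; apply/mdivisorsP.
    by exists (mmul a d); rewrite -apm -bcp mulmA (mulmC b) mulmA.
  by exists (mmul a b); rewrite mulmC -apm -bcp mulmA.
transitivity (\sum_(p <- D) \sum_(b <- D) \sum_(d <- D)
  if (mmul a p == m) && (mmul b d == p) then f a * (g b * h d) else 0).
  apply: eq_bigr => p _.
  case: eqP => [apm|_] /=; last by rewrite big1 // => b _; rewrite big1.
  transitivity (f a * fpsM g h p) => [//|].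
  rewrite (fpsM_fset g h (sub _ apm)) big_distrr; apply: eq_bigr => b _ /=.
  by rewrite big_distrr; apply: eq_bigr => d _ /=; case: ifP; rewrite ?mulr0.
rewrite exchange_big /=; apply: eq_bigr => b _.
rewrite exchange_big /=; apply: eq_bigr => d _.
case: eqP => [abdm|nabdm].
  have /andP[_ bdD] := mdivisors_factors abdm.
  rewrite (big_fsetD1 (mmul b d)) //= abdm !eqxx /= big1_seq ?addr0 // => p.
  by rewrite in_fsetD1 eq_sym => /andP[_ /andP[/negbTE-> _]]; rewrite andbF.
rewrite big1 // => p _; case: eqP => //= apm; case: eqP => // bdp.
by case: nabdm; rewrite bdp.
Qed.

Fact fpsMA : associative fpsM.
Proof.
move=> f g h; rewrite [RHS]fpsMC; apply/fpsP => m; rewrite !fpsM3.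
rewrite [RHS]exchange_big /=; apply: eq_bigr => a _.
rewrite [RHS]exchange_big /=; apply: eq_bigr => b _; apply: eq_bigr => d _.
by rewrite [mmul d _]mulmC -mulmA [h d * _]mulrC -mulrA.
Qed.

Fact fps1M : left_id (fpsC 1) fpsM.
Proof.
move=> f; apply/fpsP => m; rewrite fpsME.
have m1 : mmul mone m = m by rewrite mul1m.
have /andP[D1 Dm] := mdivisors_factors m1.
rewrite (big_fsetD1 mone) //= [X in _ + X]big1_seq ?addr0 => [|a /andP[_]].
  rewrite (big_fsetD1 m) //= m1 !eqxx mul1r big1_seq ?addr0 // => b.
  by rewrite in_fsetD1 mul1m => /andP[_ /andP[/negbTE->]].
rewrite in_fsetD1 => /andP[/negbTE a1 _]; rewrite big1 // => b _.
by rewrite a1 mul0r if_same.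
Qed.

Fact fpsMDl : left_distributive fpsM fpsD.
Proof.
move=> f g h; apply/fpsP => m; rewrite -[RHS]/(fpsM f h m + fpsM g h m).
rewrite !fpsME -big_split; apply: eq_bigr => a _ /=.
rewrite -big_split; apply: eq_bigr => b _ /=.
by case: ifP; rewrite ?addr0 // mulrDl.
Qed.

Fact fps1_neq0 : fpsC 1 != fps0.
Proof.
apply/eqP => /(congr1 (fun f : fps I K => f mone)) /=.
by rewrite eqxx => /eqP; rewrite oner_eq0.
Qed.

HB.instance Definition _ := GRing.Zmodule_isComNzRing.Build (fps I K)
  fpsMA fpsMC fps1M fpsMDl fps1_neq0.

Fact fpsZA c d f : fpsZ c (fpsZ d f) = fpsZ (c * d) f.
Proof. by apply/fpsP => m /=; rewrite mulrA. Qed.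
Fact fps1Z : left_id 1 fpsZ.
Proof. by move=> f; apply/fpsP => m /=; rewrite mul1r. Qed.
Fact fpsZDr : right_distributive fpsZ +%R.
Proof. by move=> c f g; apply/fpsP => m /=; rewrite mulrDr. Qed.
Fact fpsZDl f : {morph fpsZ^~ f : c d / c + d}.
Proof. by move=> c d; apply/fpsP => m /=; rewrite mulrDl. Qed.

HB.instance Definition _ := GRing.Zmodule_isLmodule.Build K (fps I K)
  fpsZA fps1Z fpsZDr fpsZDl.

Fact fpsZAl c f g : c *: (f * g) = (c *: f) * g.
Proof.
apply/fpsP => m; rewrite -[LHS]/(c * fpsM f g m) -[RHS]/(fpsM (c *: f) g m) !fpsME.
rewrite big_distrr; apply: eq_bigr => a _ /=.
rewrite big_distrr; apply: eq_bigr => b _ /=.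
by case: ifP; rewrite ?mulr0 // mulrA.
Qed.

HB.instance Definition _ := GRing.Lmodule_isLalgebra.Build K (fps I K) fpsZAl.

Fact fpsZAr c f g : c *: (f * g) = f * (c *: g).
Proof. by rewrite mulrC [RHS]mulrC fpsZAl. Qed.

HB.instance Definition _ := GRing.Lalgebra_isAlgebra.Build K (fps I K) fpsZAr.

End FpsRing.

(* The variable x_i. *)
Definition fpsX (I : choiceType) (K : comNzRingType) (i : I) : fps I K :=
  FPS (fun m => (m == ucm i)%:R).

(* Sum of a locally finite family of series: every coefficient is a sum with
   finite support.  (A coefficient at which infinitely many terms contribute
   would be assigned 0; this never occurs for the families used below.) *)
Definition fps_sum (T : choiceType) (I : choiceType) (K : comNzRingType)
    (u : T -> fps I K) : fps I K :=
  FPS (fun m => \sum_(x \in [set: T]) u x m).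

(* The value of the monomial m at the point s. *)
Definition mon_eval (I : choiceType) (A : comNzRingType)
    (s : I -> A) (m : {cmonom I}) : A :=
  \prod_(i <- finsupp m) s i ^+ m i.

(* f(s), where each s i is a series without constant term. *)
Definition fps_subst (I J : choiceType) (K : comNzRingType)
    (f : fps I K) (s : I -> fps J K) : fps J K :=
  fps_sum (fun m => f m *: mon_eval s m).

Definition fps_exp (I : choiceType) (K : fieldType) (f : fps I K) : fps I K :=
  fps_sum (fun n => (n`!%:R)^-1 *: f ^+ n).

Definition fps_deriv (I : choiceType) (K : comNzRingType) (i : I)
    (f : fps I K) : fps I K :=
  FPS (fun m => f (mmul m (ucm i)) *+ (m i).+1).

(* Throughout, the index k : nat stands for the time t_(k+1). *)

(* [z] = (z, z^2/2, z^3/3, ...) *)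
Definition bracket (K : fieldType) (A : algType K) (z : A) : nat -> A :=
  fun k => (k.+1%:R : K)^-1 *: z ^+ k.+1.

(* Variables of the bilinear identity: the times t, the times t', and two more
   variables, z (true) and w (false), the latter standing for z^-1. *)
Definition kp_var : choiceType := (nat + nat + bool)%type.

Section Bilinear.
Context (K : fieldType).

Definition kp_t (k : nat) : fps kp_var K := fpsX K (inl (inl k)).
Definition kp_t' (k : nat) : fps kp_var K := fpsX K (inl (inr k)).
Definition kp_z : fps kp_var K := fpsX K (inr true).
Definition kp_w : fps kp_var K := fpsX K (inr false).

(* exp(sum_k (t_k - t'_k) z^k) tau(t - [w]) tau(t' + [w]) *)
Definition kp_bilinear (tau : fps nat K) : fps kp_var K :=
  fps_exp (fps_sum (fun k => (kp_t k - kp_t' k) * kp_z ^+ k.+1))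
  * fps_subst tau (kp_t - bracket kp_w) * fps_subst tau (kp_t' + bracket kp_w).

(* The coefficient of z^-1 after w is replaced by z^-1 collects the terms
   z^n w^(n+1).  It is a series in t, t', given by its coefficients at the
   monomials m not involving z and w; the sum over n is finite because z^n
   occurs in the exponential with a coefficient of weight n in t, t'. *)
Definition kp_residue (P : fps kp_var K) (m : {cmonom kp_var}) : K :=
  \sum_(n \in [set: nat])
    P (mmul m (mmul (expcmn (ucm (inr true)) n) (expcmn (ucm (inr false)) n.+1))).

Definition is_KP_tau (tau : fps nat K) : Prop :=
  tau != 0 /\
  forall m : {cmonom kp_var}, m (inr true) = 0%N -> m (inr false) = 0%N ->
    kp_residue (kp_bilinear tau) m = 0.

(* The index k.*2.+1 is that of the even time t_(2(k+1)). *)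
Definition is_KdV_tau (tau : fps nat K) : Prop :=
  is_KP_tau tau /\ forall k, fps_deriv k.*2.+1 tau = 0.

End Bilinear.

(* For ev an evaluation of tau at points of some space of times:
     tau(t+a) tau(t-a) tau(t+b) tau(t-b)
   and
     tau(t+a) tau(t+b) tau(t-a-b) - tau(t-a) tau(t-b) tau(t+a+b). *)
Definition quad (V : zmodType) (A : comNzRingType) (ev : V -> A) (t a b : V) : A :=
  ev (t + a) * ev (t - a) * ev (t + b) * ev (t - b).

Definition cubic (V : zmodType) (A : comNzRingType) (ev : V -> A) (t a b : V) : A :=
  ev (t + a) * ev (t + b) * ev (t - a - b) - ev (t - a) * ev (t - b) * ev (t + a + b).

(* The points occurring in quad and cubic. *)
Definition shifts (V : zmodType) (t a b : V) : set V :=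
  [set t + a; t - a; t + b; t - b; t + a + b; t - a - b]%classic.

(* Variables of the formal identity: the times t and z_1, ..., z_4. *)
Definition tz_var : choiceType := (nat + 'I_4)%type.

Definition tz_t (K : comNzRingType) (k : nat) : fps tz_var K := fpsX K (inl k).
Definition tz_z (K : comNzRingType) (i : 'I_4) : fps tz_var K := fpsX K (inr i).

(* The power series tau converges unconditionally (equivalently, absolutely) at
   the numerical point s, with sum v. *)
Definition fps_converges (C : numFieldType) (tau : fps nat C) (s : nat -> C) (v : C) :=
  forall e : C, 0 < e -> exists A : {fset {cmonom nat}},
    forall B : {fset {cmonom nat}}, (A `<=` B)%fset ->
      `|\sum_(m <- B) tau m * mon_eval s m - v| < e.

(* Main.v *)
From HB Require Import structures.
Require Import Defs.
From mathcomp Require Import all_boot all_order all_algebra.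
From mathcomp Require Import finmap monalg ring.
From mathcomp Require Import mathcomp_extra boolp classical_sets functions.
From mathcomp Require Import cardinality fsbigop reals complex.

(** Give t_k the weight k.  The component of each weight of tau is a polynomial,
    so tau can be evaluated at a point x of A^nat, for any commutative ring A
    over the field of coefficients, with value a series in a formal parameter
    that records the weight.

    In the bilinear identity take t = t' + [a] + [b] + [c].  The exponential
    becomes 1/((1-az)(1-bz)(1-cz)), whose product with the Vandermonde
    determinant in a, b, c is a sum of three geometric series, and the residue
    is the Fay identity with z_0 = 0:
      sum over cyclic permutations of a(b-c) tau(t+[a]) tau(t+[b]+[c]) = 0.
    As tau does not depend on the even times, it also holds with -[a], -[b],
    -[c].  Combining the two, with N_a = tau(t+[a]) tau(t-[a]) and C_ab the
    cubic bracket, the sum of a(b-c) N_a C_bc over cyclic permutations of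
    (a,b,c) vanishes.  This cocycle identity for (z1,z2,z3) and (z1,z3,z4)
    gives the theorem.

    The formal identity is the case of the generic point.  For the numerical
    one, in which t, t+[z1]+[z3] and t+[z2]+[z4] need not be points of
    convergence, the graded identity is summed over all weights: only the
    factors of the final identity have to be absolutely summable. *)

Set Implicit Arguments.
Unset Strict Implicit.
Unset Printing Implicit Defensive.

Import Order.TTheory GRing.Theory Num.Theory.

Local Open Scope ring_scope.

(** * Monomials, gradings and coefficients *)

Arguments expcmn : simpl never.

Section Monomials.
Context (I : choiceType).
Implicit Types m a b : {cmonom I}.

(** Since [h i 0] is neutral, both supports can be enlarged to their union, where the exponents add.
    Multiplicativity of [mon_eval] and of the weight [mwt] are two instances. *)
Lemma big_cmonomM (R : Type) (idx : R) (op : Monoid.com_law idx)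
    (h : I -> nat -> R) a b :
  (forall i, h i 0%N = idx) ->
  (forall i n p, h i (n + p)%N = op (h i n) (h i p)) ->
  \big[op/idx]_(i <- finsupp (mmul a b)) h i (mmul a b i) =
  op (\big[op/idx]_(i <- finsupp a) h i (a i))
     (\big[op/idx]_(i <- finsupp b) h i (b i)).
Proof.
move=> h0 hD; rewrite mdomD.
rewrite (big_fset_incl _ (fsubsetUl (finsupp a) (finsupp b))); last first.
  by move=> i _; rewrite -cmE_neq0 negbK => /eqP ->.
rewrite (big_fset_incl _ (fsubsetUr (finsupp a) (finsupp b))); last first.
  by move=> i _; rewrite -cmE_neq0 negbK => /eqP ->.
by rewrite -big_split; apply: eq_bigr => i _; rewrite cmM hD.
Qed.

Lemma mmul_inj m : injective (mmul m).
Proof.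
move=> a b /eqP/cmP ab; apply/eqP/cmP => i.
by have /eqP := ab i; rewrite !cmM eqn_add2l => /eqP.
Qed.

Lemma expcmnE m n i : expcmn m n i = (n * m i)%N.
Proof.
case: n => [|n]; first by rewrite cm1.
rewrite /expcmn iteropS; elim: n => [|n IHn]; first by rewrite mul1n.
by rewrite iterS (cmM i m) IHn mulSn.
Qed.

Lemma expcmn0 m : expcmn m 0 = mone. Proof. by []. Qed.

Lemma expcmn1 m : expcmn m 1 = m. Proof. by []. Qed.

Lemma expcmnD m n p : expcmn m (n + p) = mmul (expcmn m n) (expcmn m p).
Proof. by apply/eqP/cmP => i; rewrite cmM !expcmnE mulnDl. Qed.

Lemma expcmnS m n : expcmn m n.+1 = mmul m (expcmn m n).
Proof. by apply/eqP/cmP => i; rewrite cmM !expcmnE mulSn. Qed.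

Lemma mdeg_expcmn m n : mdeg (expcmn m n) = (n * mdeg m)%N.
Proof.
by elim: n => [|n IHn]; rewrite ?expcmn0 ?mdeg1 // expcmnS mdegM IHn mulSn.
Qed.

End Monomials.

Section MonEval.
Context (I : choiceType) (A : comNzRingType).
Implicit Types (s : I -> A) (m a b : {cmonom I}).

Lemma mon_eval1 s : mon_eval s mone = 1.
Proof. by rewrite /mon_eval mdom1 big_seq_fset0. Qed.

Lemma mon_evalM s a b : mon_eval s (mmul a b) = mon_eval s a * mon_eval s b.
Proof.
by apply: (big_cmonomM (h := fun i n => s i ^+ n)) => // i n p; rewrite exprD.
Qed.

Lemma mon_evalU s i : mon_eval s (ucm i) = s i.
Proof. by rewrite /mon_eval mdomU big_seq_fset1 cmUU expr1. Qed.

Lemma mon_eval_expcmn s m n : mon_eval s (expcmn m n) = mon_eval s m ^+ n.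
Proof.
elim: n => [|n IHn]; first by rewrite expcmn0 mon_eval1.
by rewrite expcmnS mon_evalM IHn exprS.
Qed.

Lemma rmorph_mon_eval (B : comNzRingType) (f : {rmorphism A -> B}) s m :
  f (mon_eval s m) = mon_eval (f \o s) m.
Proof. by rewrite rmorph_prod; apply: eq_bigr => i _; rewrite rmorphXn. Qed.

End MonEval.

Section MonWeight.
Context (J L : choiceType) (wt : J -> {cmonom L}).
Implicit Types (m a b : {cmonom J}).

(** Weights are themselves monomials, in letters [L], so that a series sorted by weight is again a
    power series and several gradings can be recorded at once. *)
Definition mwt m : {cmonom L} :=
  \big[mmul/mone]_(j <- finsupp m) expcmn (wt j) (m j).

Lemma mwt1 : mwt mone = mone.
Proof. by rewrite /mwt mdom1 big_seq_fset0. Qed.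

Lemma mwtM a b : mwt (mmul a b) = mmul (mwt a) (mwt b).
Proof.
apply: (big_cmonomM (h := fun j n => expcmn (wt j) n)) => // i n p.
exact: expcmnD.
Qed.

Lemma mwtU j : mwt (ucm j) = wt j.
Proof. by rewrite /mwt mdomU big_seq_fset1 cmUU expcmn1. Qed.

Lemma mwt_expcmn m n : mwt (expcmn m n) = expcmn (mwt m) n.
Proof.
elim: n => [|n IHn]; first by rewrite expcmn0 mwt1.
by rewrite !expcmnS mwtM IHn.
Qed.

Lemma mwtE m l : mwt m l = (\sum_(j <- finsupp m) m j * wt j l)%N.
Proof.
rewrite /mwt; elim/big_ind2: _ => [|x x' y y' <- <-|j _]; first exact: cm1.
  exact: cmM.
by rewrite expcmnE.
Qed.

Lemma mdeg_mwt m : mdeg (mwt m) = (\sum_(j <- finsupp m) m j * mdeg (wt j))%N.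
Proof. by rewrite mdeg_prod; apply: eq_bigr => j _; rewrite mdeg_expcmn. Qed.

End MonWeight.

(* The two conditions make every weight space finite dimensional. *)
Record grading (J L : choiceType) := Grading {
  gwt :> J -> {cmonom L};
  gwt_gt0 : forall j, (0 < mdeg (gwt j))%N;
  gwt_finite : forall n, finite_set [set j | (mdeg (gwt j) <= n)%N]%classic }.

Section Grading.
Context (J L : choiceType) (w : grading J L).
Implicit Types (m : {cmonom J}) (l : {cmonom L}).

Lemma mwt_ge m j : (m j * mdeg (w j) <= mdeg (mwt w m))%N.
Proof.
rewrite mdeg_mwt; have [jm|] := boolP (j \in finsupp m).
  by rewrite (big_fsetD1 j) //= leq_addr.
by rewrite -cmE_eq0 => /eqP ->.
Qed.

Lemma mwt_eq1 m : mwt w m = mone -> m = mone.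
Proof.
move=> m1; apply/eqP/cmP => j; have := mwt_ge m j.
by rewrite m1 mdeg1 leqn0 muln_eq0 cm1 (gtn_eqF (gwt_gt0 w j)) orbF => /eqP.
Qed.

(** By [mwt_ge], a monomial of weight [l] involves only the finitely many variables of weight degree
    at most [mdeg l], each with exponent at most [mdeg l]. *)
Lemma fiber_finite l : finite_set [set m | mwt w m = l]%classic.
Proof.
set n := mdeg l; pose D := fset_set [set j | (mdeg (w j) <= n)%N]%classic.
have DE j : (j \in D) = (mdeg (w j) <= n)%N.
  rewrite in_fset_set; last exact: gwt_finite.
  by apply/idP/idP => [/set_mem|/mem_set].
pose T := {ffun D -> 'I_n.+1}.
pose h (f : T) : {cmonom J} := [cmonom (f i : nat) | i : D]%M.
apply: (@sub_finite_set _ _ (h @` [set: T])%classic); last first.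
  exact/finite_image/finite_finset.
move=> m /= ml; have lem j : (m j * mdeg (w j) <= n)%N.
  by rewrite /n -ml mwt_ge.
exists [ffun i => inord (m (val i))] => //.
apply/eqP/cmP => j; rewrite cmE fsfun_ffun; case: insubP => [u _ <-|].
  rewrite /= ffunE inordK // ltnS.
  by apply: leq_trans (lem (val u)); rewrite leq_pmulr // gwt_gt0.
rewrite DE -ltnNge => nj; apply/esym/eqP; rewrite -leqn0 leqNgt; apply/negP => m0.
by have := leq_trans nj (leq_trans (leq_pmull _ m0) (lem j)); rewrite ltnn.
Qed.

Definition fiber l : {fset {cmonom J}} :=
  fset_set [set m | mwt w m = l]%classic.

Lemma in_fiber l m : (m \in fiber l) = (mwt w m == l).
Proof.
rewrite in_fset_set; last exact: fiber_finite.
by apply/idP/eqP => [/set_mem|?]; last exact/mem_set.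
Qed.

Definition fibers (D : {fset {cmonom L}}) : {fset {cmonom J}} :=
  fset_set (\bigcup_(l in [set` D]) [set m | mwt w m = l])%classic.

Lemma in_fibers D m : (m \in fibers D) = (mwt w m \in D).
Proof.
rewrite in_fset_set; last by apply: bigcup_finite => // l _; exact: fiber_finite.
by apply/idP/idP => [/set_mem[l /= lD ->]//|mD]; apply/mem_set; exists (mwt w m).
Qed.

Lemma sum_fiber (V : nmodType) (F : {cmonom J} -> V) D l : l \in D ->
  \sum_(m <- fiber l) F m = \sum_(m <- fibers D | mwt w m == l) F m.
Proof.
move=> lD; rewrite -[RHS]big_filter; apply: perm_big.
apply: uniq_perm; rewrite ?filter_uniq ?fset_uniq // => m.
by rewrite mem_filter in_fiber in_fibers; case: eqP => // ->; rewrite lD.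
Qed.

End Grading.

Section FpsCoef.
Context (I : choiceType) (K : comNzRingType).
Implicit Types (f g : fps I K) (m a b : {cmonom I}) (c : K).

Lemma fps_coef0 m : (0 : fps I K) m = 0. Proof. by []. Qed.

Lemma fps_coef1 m : (1 : fps I K) m = if m == mone then 1 else 0.
Proof. by []. Qed.

Lemma fps_coefD f g m : (f + g) m = f m + g m. Proof. by []. Qed.

Lemma fps_coefN f m : (- f) m = - f m. Proof. by []. Qed.

Lemma fps_coefZ c f m : (c *: f) m = c * f m. Proof. by []. Qed.

Lemma fps_coef_sum (T : Type) (r : seq T) (P : pred T) (F : T -> fps I K) m :
  (\sum_(i <- r | P i) F i) m = \sum_(i <- r | P i) F i m.
Proof. by elim/big_rec2: _ => // i x y _ <-. Qed.

Lemma fps_coefM f g m (D : {fset {cmonom I}}) :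
  (forall a b, mmul a b = m -> (a \in D) && (b \in D)) ->
  (f * g) m = \sum_(a <- D) \sum_(b <- D) if mmul a b == m then f a * g b else 0.
Proof. exact: fpsM_fset. Qed.

Lemma fps_coefM_div f g m : (f * g) m =
  \sum_(a <- mdivisors m) \sum_(b <- mdivisors m)
    if mmul a b == m then f a * g b else 0.
Proof. exact/fps_coefM/mdivisors_factors. Qed.

Lemma fps_coefM_neq0 f g m : (f * g) m != 0 ->
  exists a b, [/\ mmul a b = m, f a != 0 & g b != 0].
Proof.
move=> fg; apply: contrapT => nfg; move/eqP: fg; apply.
rewrite fps_coefM_div big1 // => a _; rewrite big1 // => b _.
case: eqP => // abm; have [->|fa] := eqVneq (f a) 0; first by rewrite mul0r.
have [->|gb] := eqVneq (g b) 0; first by rewrite mulr0.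
by case: nfg; exists a, b.
Qed.

Lemma fps_coefM_uniq f g a b :
  (forall x y, mmul x y = mmul a b -> f x != 0 -> g y != 0 -> x = a) ->
  (f * g) (mmul a b) = f a * g b.
Proof.
move=> uab; rewrite fps_coefM_div.
have /andP[aD bD] := mdivisors_factors (erefl (mmul a b)).
rewrite (big_fsetD1 a) //= [X in _ + X]big1_seq ?addr0 => [|x].
  rewrite (big_fsetD1 b) //= eqxx big1_seq ?addr0 // => y.
  rewrite in_fsetD1 => /andP[_ /andP[yb _]]; case: eqP => // /mmul_inj yb'.
  by rewrite yb' eqxx in yb.
rewrite in_fsetD1 => /andP[_ /andP[xa _]]; rewrite big1 // => y _.
case: eqP => // xy; have [->|fx] := eqVneq (f x) 0; first by rewrite mul0r.
have [->|gy] := eqVneq (g y) 0; first by rewrite mulr0.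
by rewrite (uab _ _ xy fx gy) eqxx in xa.
Qed.

Definition fpsmon m c : fps I K := FPS (fun a => if a == m then c else 0).

Lemma fpsmon_neq0 m c a : fpsmon m c a != 0 -> a = m.
Proof. by rewrite /=; case: (a =P m) => // _; rewrite eqxx. Qed.

Lemma coef_fpsmon m c : fpsmon m c m = c.
Proof. by rewrite /= eqxx. Qed.

Lemma fpsmon1 : fpsmon mone 1 = 1. Proof. by []. Qed.

Lemma fpsXE i : fpsX K i = fpsmon (ucm i) 1.
Proof. by apply/fpsP => m /=; case: eqP. Qed.

Lemma fpsmonD m c d : fpsmon m (c + d) = fpsmon m c + fpsmon m d.
Proof. by apply/fpsP => a; rewrite fps_coefD /=; case: eqP; rewrite ?addr0. Qed.

Lemma fpsmonN m c : fpsmon m (- c) = - fpsmon m c.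
Proof. by apply/fpsP => a; rewrite fps_coefN /=; case: eqP; rewrite ?oppr0. Qed.

Lemma coef_fpsmonM m c f a : (fpsmon m c * f) (mmul m a) = c * f a.
Proof.
by rewrite fps_coefM_uniq ?coef_fpsmon // => x y _ /fpsmon_neq0.
Qed.

Lemma fpsmonM m c a d : fpsmon m c * fpsmon a d = fpsmon (mmul m a) (c * d).
Proof.
apply/fpsP => b; have [->|bma] := eqVneq b (mmul m a).
  by rewrite coef_fpsmonM !coef_fpsmon.
rewrite [RHS]/= (negbTE bma); apply/eqP/negP => /negP /fps_coefM_neq0.
move=> [x [y [xy /fpsmon_neq0 xm /fpsmon_neq0 ya]]].
by rewrite -xy xm ya eqxx in bma.
Qed.

Lemma fpsmonX m c n : fpsmon m c ^+ n = fpsmon (expcmn m n) (c ^+ n).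
Proof.
elim: n => [|n IHn]; first by rewrite expcmn0 !expr0 fpsmon1.
by rewrite !exprS IHn fpsmonM expcmnS.
Qed.

Lemma fpsmonZ m c d : d *: fpsmon m c = fpsmon m (d * c).
Proof. by apply/fpsP => a; rewrite fps_coefZ /=; case: eqP; rewrite ?mulr0. Qed.

Lemma fpsCE c : fpsC I c = fpsmon mone c. Proof. by []. Qed.

Lemma fpsC_is_zmod : zmod_morphism (@fpsC I K).
Proof. by move=> c d; rewrite !fpsCE fpsmonD fpsmonN. Qed.

Lemma fpsC_is_monoid : monoid_morphism (@fpsC I K).
Proof. by split=> // c d; rewrite !fpsCE fpsmonM mul1m. Qed.

HB.instance Definition _ := GRing.isZmodMorphism.Build K (fps I K)
  (@fpsC I K) fpsC_is_zmod.
HB.instance Definition _ := GRing.isMonoidMorphism.Build K (fps I K)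
  (@fpsC I K) fpsC_is_monoid.

Lemma fpsC_mul c f : fpsC I c * f = c *: f.
Proof.
by apply/fpsP => m; rewrite -{1}[m]mul1m fpsCE coef_fpsmonM.
Qed.

End FpsCoef.

Lemma mon_eval_fpsmon (I L : choiceType) (K : comNzRingType)
    (wt : I -> {cmonom L}) (c : I -> K) m :
  mon_eval (fun i => fpsmon (wt i) (c i)) m = fpsmon (mwt wt m) (mon_eval c m).
Proof.
rewrite /mon_eval /mwt.
elim/big_rec3: _ => [|i x y z _ ->]; first by rewrite fpsmon1.
by rewrite fpsmonX fpsmonM.
Qed.

Lemma mwt_ucm (I : choiceType) (m : {cmonom I}) : mwt (@ucm I) m = m.
Proof.
apply/eqP/cmP => i; rewrite mwtE.
have [im|] := boolP (i \in finsupp m); last first.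
  move=> im; move: (im); rewrite -cmE_eq0 => /eqP ->.
  rewrite big1_seq // => j /andP[_ jm].
  by rewrite cmU (negbTE (memPn im j jm)) muln0.
rewrite (big_fsetD1 i) //= cmUU muln1 big1_seq ?addn0 // => j.
by rewrite in_fsetD1 => /andP[_ /andP[/negbTE ji _]]; rewrite cmU ji muln0.
Qed.

Lemma mon_eval_fpsX (I : choiceType) (K : comNzRingType) (m : {cmonom I}) :
  mon_eval (@fpsX I K) m = fpsmon m 1.
Proof.
transitivity (mon_eval (fun i => fpsmon (ucm i) (1 : K)) m).
  by congr mon_eval; apply/funext => i; rewrite fpsXE.
rewrite mon_eval_fpsmon mwt_ucm /mon_eval big1 // => i _; exact: expr1n.
Qed.

(** * Graded evaluation *)

Lemma sum_if_eq (V : nmodType) (T : eqType) (r : seq T) x (F : T -> V) :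
  uniq r ->
  \sum_(i <- r) (if x == i then F i else 0) = if x \in r then F x else 0.
Proof.
move=> ur; have [xr|xr] := boolP (x \in r).
  rewrite (bigD1_seq x) //= eqxx big1 ?addr0 // => i.
  by rewrite eq_sym => /negbTE ->.
by rewrite big1_seq // => i /andP[_ ir]; rewrite eq_sym (negbTE (memPn xr i ir)).
Qed.

Lemma sum_by_image (V : nmodType) (T U : eqType) (r : seq T) (q : seq U)
    (p : T -> U) (F : T -> V) :
  uniq q -> {in r, forall x, p x \in q} ->
  \sum_(x <- r) F x = \sum_(y <- q) \sum_(x <- r | p x == y) F x.
Proof.
move=> uq pq; under [RHS]eq_bigr do rewrite big_mkcond.
rewrite exchange_big; apply: eq_big_seq => x xr /=.
by rewrite (sum_if_eq (p x) (fun=> F x)) // pq.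
Qed.

Lemma sum_fibers (V : nmodType) (J L : choiceType) (w : grading J L)
    (F : {cmonom J} -> V) D :
  \sum_(m <- fibers w D) F m = \sum_(l <- D) \sum_(m <- fiber w l) F m.
Proof.
rewrite (sum_by_image _ (fset_uniq D) (p := mwt w)) => [|m]; last first.
  by rewrite in_fibers.
by apply: eq_big_seq => l lD; rewrite (sum_fiber _ _ lD).
Qed.

Section GradedEval.
Context (J L : choiceType) (K A : comNzRingType).
Context (w : grading J L) (phi : {rmorphism K -> A}) (s : J -> A).
Implicit Types (f g : fps J K) (m : {cmonom J}) (l : {cmonom L}).

(* f is evaluated at x_j := s j * X^(w j). *)
Definition geval f : fps L A :=
  FPS (fun l => \sum_(m <- fiber w l) phi (f m) * mon_eval s m).

Lemma geval_is_zmod : zmod_morphism geval.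
Proof.
move=> f g; apply/fpsP => l; rewrite fps_coefD fps_coefN -sumrB.
by apply: eq_bigr => m _; rewrite fps_coefD fps_coefN rmorphB mulrBl.
Qed.

Lemma geval_fpsmon m c :
  geval (fpsmon m c) = fpsmon (mwt w m) (phi c * mon_eval s m).
Proof.
apply/fpsP => l /=.
under eq_bigr do rewrite (fun_if phi) rmorph0 (fun_if ( *%R^~ _)) mul0r eq_sym.
rewrite (sum_if_eq m (fun x => phi c * mon_eval s x)) ?fset_uniq //.
by rewrite in_fiber eq_sym.
Qed.

(** Every factor that contributes at weight [l] lies in the finite set [U] of monomials whose weight
    divides [l]. Over pairs from [U] the same double sum can be grouped by the product monomial or
    by the two weights. *)
Lemma gevalM f g : geval (f * g) = geval f * geval g.
Proof.
apply/fpsP => l; set D := mdivisors l.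
pose U := fibers w D; have UE m : (m \in U) = (mwt w m \in D) by exact: in_fibers.
pose F m := phi (f m) * mon_eval s m; pose G m := phi (g m) * mon_eval s m.
transitivity (\sum_(a <- U) \sum_(b <- U)
    if mwt w (mmul a b) == l then F a * G b else 0).
  transitivity (\sum_(m <- fiber w l) \sum_(a <- U) \sum_(b <- U)
      if mmul a b == m then F a * G b else 0).
    apply: eq_big_seq => m; rewrite in_fiber => /eqP ml.
    rewrite (@fps_coefM _ _ f g m U) => [|a b abm]; last first.
      by rewrite !UE; apply: mdivisors_factors; rewrite -mwtM abm.
    rewrite rmorph_sum mulr_suml; apply: eq_bigr => a _.
    rewrite rmorph_sum mulr_suml; apply: eq_bigr => b _.
    case: eqP => [<-|]; last by rewrite rmorph0 mul0r.
    by rewrite rmorphM mon_evalM mulrACA.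
  rewrite exchange_big; apply: eq_bigr => a _.
  rewrite exchange_big; apply: eq_bigr => b _ /=.
  by rewrite (sum_if_eq (mmul a b) (fun=> F a * G b)) ?fset_uniq // in_fiber.
rewrite fps_coefM_div -/D.
rewrite (sum_by_image _ (fset_uniq D) (p := mwt w)); last by move=> m; rewrite UE.
apply: eq_big_seq => x xD.
transitivity (\sum_(a <- U | mwt w a == x) \sum_(y <- D)
    \sum_(b <- U | mwt w b == y)
      if mwt w (mmul a b) == l then F a * G b else 0).
  apply: eq_bigr => a _; apply: sum_by_image => [|m]; first exact: fset_uniq.
  by rewrite UE.
rewrite exchange_big; apply: eq_big_seq => y yD /=.
case: eqP => [xyl|nxyl]; last first.
  rewrite big1 // => a /eqP ax; rewrite big1 // => b /eqP byy.
  by rewrite mwtM ax byy; case: eqP.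
rewrite !(sum_fiber _ _ (D := D)) // mulr_suml; apply: eq_bigr => a /eqP ax.
rewrite mulr_sumr; apply: eq_bigr => b /eqP byy.
by rewrite mwtM ax byy xyl eqxx.
Qed.

Lemma geval_is_monoid : monoid_morphism geval.
Proof.
split; last exact: gevalM.
by rewrite -fpsmon1 geval_fpsmon rmorph1 mon_eval1 mulr1 mwt1.
Qed.

HB.instance Definition _ := GRing.isZmodMorphism.Build (fps J K) (fps L A)
  geval geval_is_zmod.
HB.instance Definition _ := GRing.isMonoidMorphism.Build (fps J K) (fps L A)
  geval geval_is_monoid.

Lemma geval_coef1 f : geval f mone = phi (f mone).
Proof.
rewrite /= (_ : fiber w mone = [fset mone]%fset).
  by rewrite big_seq_fset1 mon_eval1 mulr1.
apply/fsetP => m; rewrite in_fiber in_fset1; apply/eqP/eqP => [/mwt_eq1//|->].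
exact: mwt1.
Qed.

End GradedEval.

(** When [u i] is homogeneous of weight [v i], only the finitely many monomials of [f] of weight [l]
    contribute to the substitution at weight [l]; the infinite sum therefore commutes with the
    evaluation. *)
Lemma geval_subst (I J L : choiceType) (K A : comNzRingType)
    (v : grading I L) (w : grading J L) (phi : {rmorphism K -> A}) (s : J -> A)
    (f : fps I K) (u : I -> fps J K) (r : I -> A) :
  (forall i m, u i m != 0 -> mwt w m = v i) ->
  (forall i, geval w phi s (u i) = fpsmon (v i) (r i)) ->
  geval w phi s (fps_subst f u) = geval v phi r f.
Proof.
move=> uv ur; apply/fpsP => l.
have hom m m' : mon_eval u m m' != 0 -> mwt w m' = mwt v m.
  rewrite /mon_eval /(mwt v).
  elim/big_rec2: _ m' => [m'|i x y _ IH m'].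
    by rewrite fps_coef1; case: (m' =P mone) => [->|]; rewrite ?eqxx ?mwt1.
  move=> /fps_coefM_neq0 [a [b [<- xa yb]]]; rewrite mwtM (IH b) //; congr mmul.
  elim: (m i) a xa => [|n IHn] a.
    by rewrite expr0 fps_coef1; case: (a =P mone) => [->|]; rewrite ?eqxx ?mwt1.
  rewrite exprS expcmnS => /fps_coefM_neq0 [a1 [a2 [<- /uv xa /IHn ya]]].
  by rewrite mwtM xa ya.
transitivity (\sum_(m' <- fiber w l) \sum_(m <- fiber v l)
    phi (f m) * (phi (mon_eval u m m') * mon_eval s m')).
  apply: eq_big_seq => m'; rewrite in_fiber => /eqP m'l.
  rewrite /= (fsbigTE (fiber v l)) => [|m].
    by rewrite rmorph_sum mulr_suml; apply: eq_bigr => m _; rewrite rmorphM mulrA.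
  rewrite in_fiber => ml; apply/eqP; apply: contraNT ml => m0.
  rewrite -m'l eq_sym; apply/eqP/hom; apply: contraNneq m0.
  by move=> ->; rewrite mulr0.
rewrite exchange_big; apply: eq_big_seq => m; rewrite in_fiber => /eqP ml /=.
rewrite -mulr_sumr; congr (_ * _).
transitivity (geval w phi s (mon_eval u m) l) => //.
rewrite rmorph_mon_eval (_ : _ \o u = fun i => fpsmon (v i) (r i)).
  by rewrite mon_eval_fpsmon ml coef_fpsmon.
by apply/funext => i /=; rewrite ur.
Qed.

Lemma geval_rmorph (J L : choiceType) (K A B : comNzRingType) (w : grading J L)
    (phi : {rmorphism K -> A}) (psi : {rmorphism K -> B})
    (h : {rmorphism A -> B}) (s : J -> A) (f : fps J K) l :
  (forall c, h (phi c) = psi c) ->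
  h (geval w phi s f l) = geval w psi (h \o s) f l.
Proof.
move=> hphi; rewrite rmorph_sum; apply: eq_bigr => m _.
by rewrite rmorphM rmorph_mon_eval hphi.
Qed.

Lemma rmorph_fps_coefM (L : choiceType) (A B : comNzRingType)
    (h : {rmorphism A -> B}) (f g : fps L A) (f' g' : fps L B) :
  (forall l, h (f l) = f' l) -> (forall l, h (g l) = g' l) ->
  forall l, h ((f * g) l) = (f' * g') l.
Proof.
move=> hf hg l; rewrite !fps_coefM_div rmorph_sum; apply: eq_bigr => a _.
rewrite rmorph_sum; apply: eq_bigr => b _.
by rewrite (fun_if h) rmorph0 rmorphM hf hg.
Qed.

(** * The Euler derivation and the exponential *)

Lemma fps_coefM_eq0 (I : choiceType) (A : comNzRingType) (f g : fps I A) m :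
  (forall a b, mmul a b = m -> f a != 0 -> g b != 0 -> False) -> (f * g) m = 0.
Proof.
move=> fg; apply: contrapT => /eqP /fps_coefM_neq0[a [b [abm fa gb]]].
exact: fg abm fa gb.
Qed.

Section Euler.
Context (I : choiceType) (K : comNzRingType) (d : {cmonom I} -> nat).
Hypothesis dM : {morph d : a b / mmul a b >-> (a + b)%N}.
Implicit Types (f g : fps I K) (m : {cmonom I}).

(** For additive [d] this is a derivation. It serves to identify the exponential through a
    differential equation. *)
Definition euler f : fps I K := FPS (fun m => f m *+ d m).

Lemma euler_is_zmod : zmod_morphism euler.
Proof.
move=> f g; apply/fpsP => m; rewrite fps_coefD fps_coefN -mulrnBl.
by rewrite -fps_coefN -fps_coefD.
Qed.

HB.instance Definition _ := GRing.isZmodMorphism.Build (fps I K) (fps I K)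
  euler euler_is_zmod.

Lemma eulerM f g : euler (f * g) = euler f * g + f * euler g.
Proof.
apply/fpsP => m; rewrite fps_coefD !fps_coefM_div -big_split /=.
rewrite -[LHS]/((f * g) m *+ d m) fps_coefM_div -sumrMnl.
apply: eq_bigr => a _; rewrite -sumrMnl -big_split; apply: eq_bigr => b _ /=.
case: eqP => [<-|_]; last by rewrite mul0rn addr0.
by rewrite dM mulrnDr mulrnAl mulrnAr.
Qed.

Lemma euler1 : euler 1 = 0.
Proof.
have := eulerM 1 1; rewrite !mulr1 mul1r => /eqP.
by rewrite -subr_eq0 opprD addrA subrr add0r oppr_eq0 => /eqP.
Qed.

Lemma eulerX f n : euler (f ^+ n.+1) = (f ^+ n * euler f) *+ n.+1.
Proof.
elim: n => [|n IHn]; first by rewrite expr1 expr0 mul1r.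
rewrite exprS eulerM IHn mulrnAr mulrA -exprS mulrC.
by rewrite [in RHS]mulrS.
Qed.

End Euler.

Section Exponential.
Context (I : choiceType) (K : fieldType).
Hypothesis K0 : forall n, n.+1%:R != 0 :> K.
Implicit Types (f g : fps I K) (m : {cmonom I}).

Lemma fps_expr_coef0 f n m : f mone = 0 -> (mdeg m < n)%N -> (f ^+ n) m = 0.
Proof.
move=> f0; elim: n m => // n IHn m; rewrite ltnS => mn.
apply/eqP/negP => /negP; rewrite exprS => /fps_coefM_neq0[a [b [abm fa fb]]].
move/eqP: fb; apply; apply: IHn; apply: leq_trans mn.
rewrite -abm mdegM -[X in (X <= _)%N]addn1 addnC leq_add2r lt0n mdeg_eq0.
by apply: contraNneq fa => ->; rewrite f0.
Qed.

Lemma fps_exp_coef f N m : f mone = 0 -> (mdeg m < N)%N ->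
  fps_exp f m = \sum_(n < N) (n`!%:R)^-1 * (f ^+ n) m.
Proof.
move=> f0 mN; rewrite /= (fsbigE (index_iota 0 N)) ?iota_uniq //.
  by under eq_bigl do rewrite in_setT; rewrite big_mkord.
move=> n _; rewrite mem_index_iota /= -leqNgt => Nn.
by rewrite fps_expr_coef0 ?mulr0 // (leq_trans mN).
Qed.

Lemma euler_exp (d : {cmonom I} -> nat) f :
  {morph d : a b / mmul a b >-> (a + b)%N} -> f mone = 0 ->
  euler d (fps_exp f) = euler d f * fps_exp f.
Proof.
move=> dM f0; apply/fpsP => m; rewrite mulrC; set N := (mdeg m).+1.
(* The coefficient at [m] sees only powers of [f] below [N], so a partial sum can replace the
   exponential. Deriving lowers the exponent by one, hence [N.+1] terms are taken on the left. *)
pose T := \sum_(n < N) (n`!%:R : K)^-1 *: f ^+ n.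
transitivity ((T * euler d f) m).
  rewrite -[LHS]/(fps_exp f m *+ d m) (@fps_exp_coef _ N.+1) //.
  rewrite -sumrMnl big_ord_recl.
  rewrite -[X in X + _ = _]mulrnAr -[X in _ * X]/(euler d 1 m) euler1 // mulr0 add0r.
  rewrite mulr_suml fps_coef_sum; apply: eq_bigr => n _.
  rewrite -scalerAl fps_coefZ -mulrnAr -[X in _ * X]/(euler d (f ^+ n.+1) m).
  rewrite eulerX // -scaler_nat fps_coefZ mulrA; congr (_ * _).
  by rewrite factS natrM invfM mulrAC mulVf ?mul1r.
rewrite !fps_coefM_div; apply: eq_bigr => a _; apply: eq_bigr => b _.
case: eqP => // abm; congr (_ * _); rewrite (@fps_exp_coef _ N) //.
  by rewrite fps_coef_sum.
by rewrite ltnS -abm mdegM leq_addr.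
Qed.

End Exponential.

Lemma coef1M (I : choiceType) (A : comNzRingType) (f g : fps I A) :
  (f * g) mone = f mone * g mone.
Proof.
rewrite -{1}(mul1m (mone : {cmonom I})) fps_coefM_uniq // => x y /eqP.
by rewrite mul1m cmM_eq1 => /andP[/eqP-> _].
Qed.

(* In {cmonom bool} the letter true marks the weight in the times and w, the
   letter false the degree in z. *)
Definition bideg (l : {cmonom bool}) : nat := l true + l false.

Lemma bidegM : {morph bideg : a b / mmul a b >-> (a + b)%N}.
Proof. by move=> a b; rewrite /bideg !cmM addnACA. Qed.

Lemma bideg_eq0 l : (bideg l == 0%N) = (l == mone).
Proof.
apply/idP/eqP => [|->]; last by rewrite /bideg !cm1.
by rewrite addn_eq0 => /andP[/eqP t0 /eqP f0]; apply/eqP/cmP => -[];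
  rewrite cm1.
Qed.

(** * The exponential factor as a combination of three geometric series *)

Section GeometricSeries.
Context (B : comNzRingType) (Ga Gb Gc y : B).

(** The left side is the Euler derivative of (1-Ua)(1-Ub)(1-Uc)y when each U has degree 2 and y has
    logarithmic derivative 2(Ua Ga + Ub Gb + Uc Gc), with G the inverse of 1-U. Its vanishing makes
    y the inverse of the product. *)
Lemma geometric_log_derivative (Ua Ub Uc : B) :
  (1 - Ua) * Ga = 1 -> (1 - Ub) * Gb = 1 -> (1 - Uc) * Gc = 1 ->
  ((- (Ua *+ 2) * (1 - Ub) + (1 - Ua) * - (Ub *+ 2)) * (1 - Uc)
   + (1 - Ua) * (1 - Ub) * - (Uc *+ 2)) * y
  + (1 - Ua) * (1 - Ub) * (1 - Uc)
    * ((Ua * Ga + Ub * Gb + Uc * Gc) *+ 2 * y) = 0.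
Proof.
move=> ha hb hc.
transitivity (
  (Ua * (1 - Ub) * (1 - Uc) * y * ((1 - Ua) * Ga - 1) +
   Ub * (1 - Ua) * (1 - Uc) * y * ((1 - Ub) * Gb - 1) +
   Uc * (1 - Ua) * (1 - Ub) * y * ((1 - Uc) * Gc - 1)) *+ 2); first by ring.
by rewrite ha hb hc subrr !mulr0 !addr0 mul0rn.
Qed.

(** Partial fractions for 1/((1-au)(1-bu)(1-cu)), multiplied by the Vandermonde determinant (up to
    sign) so that no difference of a, b, c has to be inverted. *)
Lemma geometric_partial_fractions (a b c u : B) :
  (1 - a * u) * Ga = 1 -> (1 - b * u) * Gb = 1 -> (1 - c * u) * Gc = 1 ->
  (1 - a * u) * (1 - b * u) * (1 - c * u) * y = 1 ->
  (a ^+ 2 * (b - c) + b ^+ 2 * (c - a) + c ^+ 2 * (a - b)) * y =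
  a ^+ 2 * (b - c) * Ga + b ^+ 2 * (c - a) * Gb + c ^+ 2 * (a - b) * Gc.
Proof.
move=> ha hb hc hy.
have ea : (1 - b * u) * (1 - c * u) * y = Ga.
  by rewrite -[LHS]mulr1 -[X in _ * X = _]ha -[RHS]mulr1 -[in RHS]hy; ring.
have eb : (1 - a * u) * (1 - c * u) * y = Gb.
  by rewrite -[LHS]mulr1 -[X in _ * X = _]hb -[RHS]mulr1 -[in RHS]hy; ring.
have ec : (1 - a * u) * (1 - b * u) * y = Gc.
  by rewrite -[LHS]mulr1 -[X in _ * X = _]hc -[RHS]mulr1 -[in RHS]hy; ring.
by rewrite -ea -eb -ec; ring.
Qed.

End GeometricSeries.

Section Kernel.
Context (K : fieldType) (A : comNzRingType) (phi : {rmorphism K -> A}).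
Hypothesis K0 : forall n, n.+1%:R != 0 :> K.
Implicit Types (a b c : A) (l : {cmonom bool}).

(** The sum of [e n] times the n-th power of [lz]. The phase is of this form because t_k, of weight
    k, comes with z^k. *)
Definition diag (e : nat -> A) : fps bool A :=
  FPS (fun l => if l true == l false then e (l true) else 0).

Definition lz : {cmonom bool} := locked (mmul (ucm true) (ucm false)).

Lemma lzE i : lz i = 1%N. Proof. by rewrite /lz -lock cmM !cmU; case: i. Qed.

Lemma lzM_diag a e :
  fpsmon lz a * diag e = diag (fun n => if n is p.+1 then a * e p else 0).
Proof.
apply/fpsP => l; have [l0|] := eqVneq (l true * l false)%N 0%N.
  rewrite [RHS](_ : _ = 0); last first.
    by rewrite /=; case: eqP l0 => [->|//] /eqP; rewrite muln_eq0 orbb => /eqP ->.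
  apply: fps_coefM_eq0 => x y xyl /fpsmon_neq0 xlz _.
  have lE i : l i = (y i).+1 by rewrite -xyl xlz cmM lzE.
  by move: l0; rewrite !lE.
rewrite muln_eq0 negb_or -!lt0n => /andP[t0 f0].
pose l' : {cmonom bool} :=
  mmul (expcmn (ucm true) (l true).-1) (expcmn (ucm false) (l false).-1).
have -> : l = mmul lz l'.
  by apply/eqP/cmP => -[]; rewrite !cmM lzE !expcmnE !cmU ?muln1 ?muln0
    ?addn0 ?add0n add1n prednK.
rewrite coef_fpsmonM /= !cmM !lzE !add1n eqSS.
by case: eqP; rewrite ?mulr0.
Qed.

Lemma geo_inv a : (1 - fpsmon lz a) * diag (fun n => a ^+ n) = 1.
Proof.
rewrite mulrBl mul1r lzM_diag; apply/fpsP => l.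
rewrite fps_coefD fps_coefN fps_coef1 -bideg_eq0 addn_eq0 /=.
case: eqP => [<-|]; last first.
  by rewrite subr0; case: ifP => // /andP[/eqP-> /eqP->].
by case: (l true) => [|n]; rewrite ?subr0 //= exprS subrr.
Qed.

Let phiK n x : phi n.+1%:R^-1 * x *+ n.+1 = x.
Proof.
rewrite -mulr_natr -(rmorph_nat phi) mulrAC -rmorphM mulVf //.
by rewrite rmorph1 mul1r.
Qed.

(** Away from [mone] the degree is a positive integer, invertible by [K0]. *)
Lemma euler_bideg_eq0 (f : fps bool A) :
  euler bideg f = 0 -> f = fpsC bool (f mone).
Proof.
move=> f0; apply/fpsP => l; rewrite /fpsC /=.
case: (l =P mone) => [->//|/eqP]; rewrite -bideg_eq0 => l1.
have /(congr1 (fun f : fps bool A => phi (bideg l)%:R^-1 * f l)) := f0.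
by rewrite /= mulr0; case: (bideg l) l1 => // n _; rewrite mulrnAr phiK.
Qed.

(** Here g is minus the logarithm of (1-au)(1-bu)(1-cu), with u the monomial [lz], and y its
    exponential. As [A] is only a ring, y enters through its Euler equation and its constant term,
    which determine it. *)
Lemma kernelE (y g : fps bool A) a b c :
  g = diag (fun n => phi n%:R^-1 * (a ^+ n + b ^+ n + c ^+ n)) ->
  euler bideg y = euler bideg g * y -> y mone = 1 ->
  fpsC bool (a ^+ 2 * (b - c) + b ^+ 2 * (c - a) + c ^+ 2 * (a - b)) * y =
  diag (fun n => a ^+ n.+2 * (b - c) + b ^+ n.+2 * (c - a)
               + c ^+ n.+2 * (a - b)).
Proof.
move=> gE yE y1.
pose G x := diag (fun n => x ^+ n); pose U (x : A) := fpsmon lz x.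
have GU x : (1 - U x) * G x = 1 by exact: geo_inv.
(* The n-th power of [lz] has [bideg] 2n, which cancels the 1/n in [g] and leaves a factor 2. *)
have eG : euler bideg g = (U a * G a + U b * G b + U c * G c) *+ 2.
  apply/fpsP => l; rewrite mulr2n !fps_coefD !lzM_diag gE /=.
  rewrite /bideg; case: eqP => [<-|]; last by rewrite mul0rn !addr0.
  case: (l true) => [|n]; first by rewrite !addr0.
  by rewrite -!exprS mulrnDr phiK.
have eU x : euler bideg (1 - U x) = - (U x *+ 2).
  rewrite raddfB [X in X - _](euler1 _ bidegM) sub0r; congr (- _).
  apply/fpsP => l; rewrite mulr2n fps_coefD /=.
  by case: eqP => [->|]; rewrite ?mul0rn ?addr0 // /bideg !lzE mulr2n.
pose D := (1 - U a) * (1 - U b) * (1 - U c).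
have Dy : D * y = 1.
  have eDy : euler bideg (D * y) = 0.
    rewrite !(eulerM bidegM) yE !eU eG.
    by apply: geometric_log_derivative; exact: GU.
  have U0 x : U x mone = 0.
    rewrite -[LHS]/(if mone == lz then x else 0) ifN //.
    by rewrite eq_sym -bideg_eq0 /bideg !lzE.
  rewrite (euler_bideg_eq0 eDy) !coef1M y1 !fps_coefD !fps_coefN !U0.
  by rewrite fps_coef1 eqxx subr0 !mulr1.
have kE (x : A) : U x = fpsC bool x * U 1.
  by rewrite /U fpsCE fpsmonM mul1m mulr1.
have := @geometric_partial_fractions _ (G a) (G b) (G c) y
  (fpsC bool a) (fpsC bool b) (fpsC bool c) (U 1).
rewrite -!kE => /(_ (GU a) (GU b) (GU c) Dy).
rewrite -!(rmorphXn, rmorphB, rmorphM, rmorphD) => ->.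
apply/fpsP => l; rewrite !fps_coefD !fpsC_mul !fps_coefZ /diag /=.
case: (l true =P l false) => _; last by rewrite !mulr0 !addr0.
by rewrite (mulrAC (a ^+ 2)) (mulrAC (b ^+ 2)) (mulrAC (c ^+ 2)) -!exprD.
Qed.

End Kernel.

(** * Gradings of the times and of the bilinear variables *)

Section Support.
Context (I : choiceType) (K : comNzRingType) (S : pred {cmonom I}).
Hypotheses (S1 : S mone) (SM : forall a b, S a -> S b -> S (mmul a b)).
Implicit Types f g : fps I K.

(** Used with [S] a fixed weight, to express homogeneity, and with [S] an inequality between
    degrees, to bound the support of [kp_bilinear]. *)
Definition supported f := forall m, f m != 0 -> S m.

Lemma supportedM f g : supported f -> supported g -> supported (f * g).
Proof.
move=> fS gS m /fps_coefM_neq0[a [b [<- /fS Sa /gS Sb]]]; exact: SM.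
Qed.

Lemma supportedX f n : supported f -> supported (f ^+ n).
Proof.
move=> fS; elim: n => [|n IHn]; last by rewrite exprS; exact: supportedM.
by move=> m; rewrite expr0 fps_coef1; case: (m =P mone) => [->//|]; rewrite eqxx.
Qed.

Lemma supportedZ c f : supported f -> supported (c *: f).
Proof.
move=> fS m cfm; apply: fS; apply: contraNneq cfm => fm.
by rewrite fps_coefZ fm mulr0.
Qed.

Lemma supportedN f : supported f -> supported (- f).
Proof. by rewrite -scaleN1r; exact: supportedZ. Qed.

Lemma supportedD f g : supported f -> supported g -> supported (f + g).
Proof.
move=> fS gS m; rewrite fps_coefD; have [fm|/fS//] := eqVneq (f m) 0.
by rewrite fm add0r => /gS.
Qed.

Lemma supported_sum (T : choiceType) (u : T -> fps I K) :
  (forall x, supported (u x)) -> supported (fps_sum u).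
Proof.
move=> uS m; apply: contraNT => nSm; apply/eqP/fsbig1 => x _.
by apply/eqP; apply: contraNT nSm; exact: uS.
Qed.

Lemma supported_subst (J : choiceType) (f : fps J K) (u : J -> fps I K) :
  (forall j, supported (u j)) -> supported (fps_subst f u).
Proof.
move=> uS; apply: supported_sum => m; apply: supportedZ.
rewrite /mon_eval; elim/big_rec: _ => [|j x _ xS].
  by rewrite -(expr0 0); apply: supportedX => a; rewrite fps_coef0 eqxx.
by apply: supportedM => //; exact: supportedX.
Qed.

End Support.

Lemma supported_exp (I : choiceType) (K : fieldType) (S : pred {cmonom I})
    (f : fps I K) :
  S mone -> (forall a b, S a -> S b -> S (mmul a b)) ->
  supported S f -> supported S (fps_exp f).
Proof.
move=> S1 SM fS; apply: supported_sum => n; apply: supportedZ.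
exact: supportedX.
Qed.

Lemma mon_eval_mul (I : choiceType) (A : comNzRingType) (s r : I -> A) m :
  mon_eval (fun i => s i * r i) m = mon_eval s m * mon_eval r m.
Proof. by rewrite -big_split; apply: eq_bigr => i _; rewrite exprMn. Qed.

Lemma mon_eval_delta (I : choiceType) (A : comNzRingType) (y : A) i
    (m : {cmonom I}) :
  mon_eval (fun j => if j == i then y else 1) m = y ^+ m i.
Proof.
rewrite /mon_eval; have [im|im] := boolP (i \in finsupp m).
  rewrite (big_fsetD1 i) //= eqxx big1_seq ?mulr1 // => j /andP[_].
  by rewrite in_fsetD1 => /andP[/negbTE-> _]; rewrite expr1n.
move: (im); rewrite -cmE_eq0 => /eqP ->; rewrite big1_seq // => j /andP[_ jm].
by rewrite (negbTE (memPn im j jm)) expr1n.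
Qed.

Lemma sum_finsupp_delta (I : choiceType) (m : {cmonom I}) i :
  (\sum_(j <- finsupp m) m j * (j == i))%N = m i.
Proof.
rewrite -[in RHS](mwt_ucm m) mwtE.
by apply: eq_bigr => j _; rewrite cmU.
Qed.

Section MoreEval.
Context (J L : choiceType) (K A : comNzRingType).
Context (w : grading J L) (phi : {rmorphism K -> A}) (s : J -> A).

Lemma geval_fps_sum (T : choiceType) (u : T -> fps J K) l (F : {fset T}) :
  (forall x m, u x m != 0 -> mwt w m = l -> x \in F) ->
  geval w phi s (fps_sum u) l = \sum_(x <- F) geval w phi s (u x) l.
Proof.
move=> uF; rewrite exchange_big; apply: eq_big_seq => m.
rewrite in_fiber => /eqP ml /=; rewrite (fsbigTE F) => [|x].
  by rewrite rmorph_sum mulr_suml.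
by move=> xF; apply/eqP; apply: contraNT xF => /uF; exact.
Qed.

Lemma geval_euler (d : {cmonom L} -> nat) f :
  geval w phi s (euler (d \o mwt w) f) = euler d (geval w phi s f).
Proof.
apply/fpsP => l /=; rewrite -sumrMnl; apply: eq_big_seq => m.
by rewrite in_fiber => /eqP <-; rewrite rmorphMn mulrnAl.
Qed.

End MoreEval.

Local Notation lam := (ucm true).
Local Notation zet := (ucm false).

Lemma lz_expE n : expcmn lz n = mmul (expcmn lam n) (expcmn zet n).
Proof.
by apply/eqP/cmP => i; rewrite cmM !expcmnE lzE !cmU; case: i;
  rewrite ?muln0 ?addn0.
Qed.

Lemma mdeg_lam n : mdeg (expcmn lam n) = n.
Proof. by rewrite mdeg_expcmn mdegU muln1. Qed.

(* The index k is that of t_(k+1), hence k.+1. *)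
Definition time_weight (k : nat) : {cmonom bool} := expcmn lam k.+1.

Lemma time_weight_gt0 k : (0 < mdeg (time_weight k))%N.
Proof. by rewrite mdeg_lam. Qed.

Lemma time_weight_finite n :
  finite_set [set k | (mdeg (time_weight k) <= n)%N]%classic.
Proof.
by apply: sub_finite_set (finite_II n) => k /=; rewrite mdeg_lam.
Qed.

Definition time_grading := Grading time_weight_gt0 time_weight_finite.

(** Since w has weight 1, t - [w] and t' + [w] are homogeneous of the weights of the times. The
    variable z has a letter of its own, from which its degree is read off. *)
Definition kp_weight (j : kp_var) : {cmonom bool} :=
  match j with
  | inl (inl k) => time_weight k
  | inl (inr k) => time_weight k
  | inr true => zet
  | inr false => lam
  end.

Lemma kp_weight_gt0 j : (0 < mdeg (kp_weight j))%N.
Proof.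
by case: j => [[k|k]|[]]; rewrite /kp_weight ?mdegU ?time_weight_gt0.
Qed.

Lemma kp_weight_finite n :
  finite_set [set j | (mdeg (kp_weight j) <= n)%N]%classic.
Proof.
pose D := [set k | (mdeg (time_weight k) <= n)%N]%classic.
have finD : finite_set D by exact: time_weight_finite.
apply: (@sub_finite_set _ _ ((fun k => inl (inl k) : kp_var) @` D
  `|` (fun k => inl (inr k) : kp_var) @` D
  `|` (inr : bool -> kp_var) @` setT)%classic).
  move=> [[k|k]|b] /= kn.
  - by left; left; exists k.
  - by left; right; exists k.
  - by right; exists b.
by rewrite !finite_setU; split; [split|]; apply: finite_image => //;
  exact: finite_finset.
Qed.

Definition kp_grading := Grading kp_weight_gt0 kp_weight_finite.

Definition tau_bilinear (K : fieldType) (tau : fps nat K) :=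
  forall m : {cmonom kp_var}, m (inr true) = 0%N -> m (inr false) = 0%N ->
    kp_residue (kp_bilinear tau) m = 0.

(** * Extraction of the residue from the graded evaluation *)

Definition residue_mon i : {cmonom kp_var} :=
  mmul (expcmn (ucm (inr true)) i) (expcmn (ucm (inr false)) i.+1).

Lemma kp_weight_z (m : {cmonom kp_var}) :
  mwt kp_weight m false = m (inr true).
Proof.
rewrite mwtE -[RHS]sum_finsupp_delta; apply: eq_bigr => j _; congr (_ * _)%N.
by case: j => [[k|k]|[]]; rewrite /kp_weight /time_weight ?expcmnE cmU ?muln0.
Qed.

Lemma residue_monE i j : residue_mon i j =
  (i * (inr true == j) + i.+1 * (inr false == j))%N.
Proof. by rewrite cmM !expcmnE !cmU. Qed.

Lemma residue_mon_weight i :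
  mwt kp_weight (residue_mon i) = mmul (expcmn lam i.+1) (expcmn zet i).
Proof. by rewrite mwtM !mwt_expcmn !mwtU mulmC. Qed.

Lemma kp_residue_sum (K : fieldType) (P : fps kp_var K) m B :
  (forall i, (B <= i)%N -> P (mmul m (residue_mon i)) = 0) ->
  kp_residue P m = \sum_(i < B) P (mmul m (residue_mon i)).
Proof.
move=> P0; rewrite /kp_residue (fsbigE (index_iota 0 B)) ?iota_uniq //.
  by under eq_bigl do rewrite in_setT; rewrite big_mkord.
by move=> i _; rewrite mem_index_iota /= -leqNgt; exact: P0.
Qed.

Section Residue.
Context (K : fieldType) (A : comNzRingType) (phi : {rmorphism K -> A}).
Context (x x' : nat -> A).

(* The point of evaluation: t = x, t' = x', z = 1 and w = 'X; the degree in z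
   is recorded by the grading. *)
Definition kp_point (j : kp_var) : {poly A} :=
  match j with
  | inl (inl k) => (x k)%:P
  | inl (inr k) => (x' k)%:P
  | inr true => 1
  | inr false => 'X
  end.

Definition time_point (j : kp_var) : A :=
  match j with inl (inl k) => x k | inl (inr k) => x' k | inr _ => 1 end.

Lemma mon_eval_kp_point m :
  mon_eval kp_point m = (mon_eval time_point m)%:P * 'X^(m (inr false)).
Proof.
rewrite -mon_eval_delta (rmorph_mon_eval (@polyC A)) -mon_eval_mul.
congr mon_eval; apply/funext => -[[k|k]|[]] /=; by rewrite ?mulr1 ?mul1r.
Qed.

Lemma mon_eval_residue_mon i : mon_eval time_point (residue_mon i) = 1.
Proof. by rewrite mon_evalM !mon_eval_expcmn !mon_evalU !expr1n mulr1. Qed.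

Let ev := geval kp_grading (@polyC A \o phi) kp_point.

(** The weight of z^i w^(i+1) times a monomial of weight [N] in t and t'. *)
Definition residue_weight N i : {cmonom bool} :=
  mmul (expcmn lam N) (mmul (expcmn lam i.+1) (expcmn zet i)).

(** The letter [zet] fixes the exponent of z at i, and the coefficient of 'X^(i+1) fixes that of w
    at i+1. The monomials left are those of weight [N] in t and t' alone, multiplied by
    [residue_mon i]. *)
Lemma geval_residue (P : fps kp_var K) N i :
  (ev P (residue_weight N i))`_i.+1 =
  \sum_(m <- fiber kp_grading (expcmn lam N) | m (inr false) == 0%N)
    phi (P (mmul m (residue_mon i))) * mon_eval time_point m.
Proof.
rewrite coef_sum.
transitivity (\sum_(m <- fiber kp_grading (residue_weight N i)
    | m (inr false) == i.+1) phi (P m) * mon_eval time_point m).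
  rewrite [RHS]big_mkcond; apply: eq_bigr => m _ /=.
  rewrite mon_eval_kp_point mulrA -polyCM coefCM coefXn eq_sym.
  by case: eqP; rewrite ?mulr1 ?mulr0.
pose f m : {cmonom kp_var} := mmul m (residue_mon i).
pose r := filter (fun m : {cmonom kp_var} => m (inr false) == 0%N)
  (fiber kp_grading (expcmn lam N)).
transitivity (\sum_(m <- map f r) phi (P m) * mon_eval time_point m); last first.
  rewrite big_map big_filter; apply: eq_bigr => m _.
  by rewrite mon_evalM mon_eval_residue_mon mulr1.
rewrite -[LHS]big_filter; apply: perm_big; apply: uniq_perm.
- by rewrite filter_uniq ?fset_uniq.
- rewrite map_inj_uniq ?filter_uniq ?fset_uniq //.
  by move=> m m'; rewrite /f !(mulmC _ (residue_mon i)) => /mmul_inj.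
move=> m; rewrite mem_filter in_fiber; apply/andP/mapP => [[/eqP mw /eqP mN]|].
  pose m' := divcm m (residue_mon i).
  have mE : m = f m'.
    apply/eqP/cmP => j; rewrite cmM divcmE subnK // residue_monE.
    case: j => [[k|k]|[]] //=; rewrite ?muln0 ?muln1 ?addn0 ?add0n ?mw //.
    rewrite -kp_weight_z -[kp_weight]/(gwt kp_grading) mN.
    by rewrite !cmM !expcmnE !cmU !muln0 muln1.
  exists m' => //; rewrite mem_filter in_fiber; apply/andP; split.
    by rewrite divcmE residue_monE mw /= muln0 muln1 subnn.
  move: mN; rewrite mE mwtM residue_mon_weight.
  by rewrite [RHS]mulmC [LHS]mulmC => /mmul_inj ->.
move=> [m']; rewrite mem_filter in_fiber => /andP[/eqP m'w /eqP m'N] ->.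
rewrite cmM m'w residue_monE /= muln0 muln1; split => //.
by rewrite mwtM m'N residue_mon_weight.
Qed.

(** For a monomial of weight [N] in the times, the support condition at z^i w^(i+1) reads i + (i+1)
    <= N + (i+1), that is i <= N. Hence the first [B] terms already form the whole residue. *)
Lemma geval_residue_sum (P : fps kp_var K) N B :
  (forall m : {cmonom kp_var}, P m != 0 ->
    (m (inr true) + m (inr false) <= mwt kp_weight m true)%N) ->
  (N < B)%N ->
  (forall m : {cmonom kp_var}, m (inr true) = 0%N -> m (inr false) = 0%N ->
    kp_residue P m = 0) ->
  \sum_(i < B) (ev P (residue_weight N i))`_i.+1 = 0.
Proof.
move=> Psupp NB Pres; under eq_bigr do rewrite geval_residue.
rewrite exchange_big big1_seq // => m /andP[/eqP mw]; rewrite in_fiber => /eqP mN.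
rewrite -mulr_suml -rmorph_sum -kp_residue_sum ?Pres ?rmorph0 ?mul0r //.
  by rewrite -kp_weight_z -[kp_weight]/(gwt kp_grading) mN expcmnE cmU muln0.
move=> i Bi; apply/eqP; apply/negP => /negP /Psupp; apply/negP.
rewrite -ltnNge mwtM -[kp_weight]/(gwt kp_grading) mN residue_mon_weight.
rewrite !(cmM _ m) !residue_monE mw !cmM !expcmnE !cmU /= !muln0 !muln1 !addn0 add0n.
rewrite ltn_add2r.
by rewrite (leq_trans _ (leq_addl _ _)) // (leq_trans NB).
Qed.

End Residue.

(** * The factors of the bilinear identity *)

Lemma fpsmonB (I : choiceType) (K : comNzRingType) (m : {cmonom I}) (c d : K) :
  fpsmon m (c - d) = fpsmon m c - fpsmon m d.
Proof. by rewrite fpsmonD fpsmonN. Qed.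

(** The point [z] over a ring that receives the field through a morphism, rather than over an
    algebra. *)
Definition rbracket (K : fieldType) (A : comNzRingType)
    (phi : {rmorphism K -> A}) (z : A) : nat -> A :=
  fun k => phi k.+1%:R^-1 * z ^+ k.+1.

Section KpVariables.
Context (K : fieldType).

Lemma kp_tE k : kp_t K k = @fpsmon kp_var K (@ucm kp_var (inl (inl k))) 1.
Proof. exact: fpsXE. Qed.

Lemma kp_t'E k : kp_t' K k = @fpsmon kp_var K (@ucm kp_var (inl (inr k))) 1.
Proof. exact: fpsXE. Qed.

Lemma kp_zE : kp_z K = @fpsmon kp_var K (@ucm kp_var (inr true)) 1.
Proof. exact: fpsXE. Qed.

Lemma kp_wE : kp_w K = @fpsmon kp_var K (@ucm kp_var (inr false)) 1.
Proof. exact: fpsXE. Qed.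

Lemma bracket_kp_w k : bracket (kp_w K) k =
  @fpsmon kp_var K (expcmn (@ucm kp_var (inr false)) k.+1) k.+1%:R^-1.
Proof. by rewrite /bracket kp_wE fpsmonX expr1n fpsmonZ mulr1. Qed.

End KpVariables.

Definition kp_phase (K : fieldType) : fps kp_var K :=
  fps_sum (fun k => (kp_t K k - kp_t' K k) * kp_z K ^+ k.+1).

Section Bilinear.
Context (K : fieldType) (A : comNzRingType) (phi : {rmorphism K -> A}).
Hypothesis K0 : forall n, n.+1%:R != 0 :> K.
Context (tau : fps nat K) (x x' : nat -> A).

Let phiX : {rmorphism K -> {poly A}} := @polyC A \o phi.
Local Notation ev := (geval kp_grading phiX (kp_point x x')).

Lemma geval_tau_shift (v : nat -> kp_var) (e : K) :
  (forall k, kp_weight (v k) = time_weight k) ->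
  ev (fps_subst tau (fun k => fpsX K (v k) + e *: bracket (kp_w K) k)) =
  geval time_grading phiX
    (fun k => kp_point x x' (v k) + phiX e * rbracket phiX 'X k) tau.
Proof.
move=> vw; have ww k : mwt kp_grading (expcmn (@ucm kp_var (inr false)) k.+1) =
    time_grading k by rewrite mwt_expcmn mwtU.
apply: geval_subst => [k m|k].
  rewrite bracket_kp_w fpsmonZ fpsXE fps_coefD /=.
  case: (m =P ucm (v k)) => [-> _|_]; first by rewrite mwtU -vw.
  case: (m =P _) => [-> _|_]; first exact: ww.
  by rewrite addr0 eqxx.
rewrite bracket_kp_w fpsmonZ fpsXE rmorphD /= !geval_fpsmon ww mwtU.
rewrite [kp_grading (v k)]vw -fpsmonD rmorph1 mul1r mon_eval_expcmn !mon_evalU.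
by rewrite rmorphM -mulrA.
Qed.

Lemma kp_phase_term k m :
  ((kp_t K k - kp_t' K k) * kp_z K ^+ k.+1) m != 0 ->
  mwt kp_weight m = expcmn lz k.+1 /\ m (inr false) = 0%N.
Proof.
move=> /fps_coefM_neq0[a [b [<- ta]]].
rewrite kp_zE fpsmonX => /fpsmon_neq0 ->.
suff [aw a0] : mwt kp_weight a = time_weight k /\ a (inr false) = 0%N.
  by rewrite mwtM mwt_expcmn mwtU aw lz_expE cmM a0 expcmnE cmU muln0.
move: ta; rewrite kp_tE kp_t'E fps_coefD fps_coefN /=.
do 2![case: (a =P _) => [-> _|_]; first by rewrite mwtU cmU].
by rewrite subr0 eqxx.
Qed.

Lemma geval_kp_phase : ev (kp_phase K) =
  diag (fun n => if n is k.+1 then (x k - x' k)%:P else 0).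
Proof.
have term k : ev ((kp_t K k - kp_t' K k) * kp_z K ^+ k.+1) =
    fpsmon (expcmn lz k.+1) (x k - x' k)%:P.
  have e1 : ev (kp_t K k) = fpsmon (time_weight k) (x k)%:P.
    by rewrite kp_tE geval_fpsmon mwtU mon_evalU rmorph1 mul1r.
  have e2 : ev (kp_t' K k) = fpsmon (time_weight k) (x' k)%:P.
    by rewrite kp_t'E geval_fpsmon mwtU mon_evalU rmorph1 mul1r.
  have e3 : ev (kp_z K ^+ k.+1) = fpsmon (expcmn zet k.+1) 1.
    rewrite kp_zE fpsmonX geval_fpsmon mwt_expcmn mwtU mon_eval_expcmn.
    by rewrite mon_evalU !expr1n rmorph1 mul1r.
  transitivity ((fpsmon (time_weight k) (x k)%:P
      - fpsmon (time_weight k) (x' k)%:P) * fpsmon (expcmn zet k.+1) 1).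
    rewrite gevalM geval_is_zmod.
    exact: (f_equal2 *%R (f_equal2 (fun p q => p - q) e1 e2) e3).
  by rewrite -fpsmonB fpsmonM lz_expE mulr1 polyCB.
apply/fpsP => l; rewrite [RHS]/=.
have supp k m : ((kp_t K k - kp_t' K k) * kp_z K ^+ k.+1) m != 0 ->
    mwt kp_grading m = l -> l true = k.+1 /\ l false = k.+1.
  by move=> /kp_phase_term[mE _] <-; rewrite /= mE !expcmnE !lzE !muln1.
case: eqP => [ltf|ltf]; last first.
  rewrite /kp_phase (@geval_fps_sum _ _ _ _ _ _ _ _ _ _ fset0).
    by rewrite big_seq_fset0.
  by move=> k m /supp s /s[lt lf]; case: ltf; rewrite lt lf.
case lt: (l true) => [|n].
  rewrite /kp_phase (@geval_fps_sum _ _ _ _ _ _ _ _ _ _ fset0).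
    by rewrite big_seq_fset0.
  by move=> k m /supp s /s[]; rewrite lt.
rewrite /kp_phase (@geval_fps_sum _ _ _ _ _ _ _ _ _ _ [fset n]%fset).
  rewrite big_seq_fset1 term /= ifT //; apply/cmP => i.
  by rewrite expcmnE lzE muln1; case: i; rewrite -?ltf.
by move=> k m /supp s /s[]; rewrite lt in_fset1 => -[->].
Qed.

Lemma kp_phase_mone : kp_phase K mone = 0.
Proof.
apply: fsbig1 => k _; apply/eqP; apply/negP => /negP /kp_phase_term[].
by rewrite mwt1 => /eqP/cmP/(_ true); rewrite cm1 expcmnE lzE.
Qed.

(** With t - t' = [a] + [b] + [c] the phase becomes the sum of (a^n + b^n + c^n)/n times the n-th
    power of [lz], to which [kernelE] applies. *)
Lemma geval_kp_exp a b c :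
  (forall k, x k - x' k = rbracket phi a k + rbracket phi b k + rbracket phi c k) ->
  fpsC bool ((a ^+ 2 * (b - c) + b ^+ 2 * (c - a) + c ^+ 2 * (a - b))%:P)
    * ev (fps_exp (kp_phase K)) =
  diag (fun n => (a ^+ n.+2 * (b - c) + b ^+ n.+2 * (c - a)
                 + c ^+ n.+2 * (a - b))%:P).
Proof.
move=> xx'.
have polyE n : (a ^+ n.+2 * (b - c) + b ^+ n.+2 * (c - a)
      + c ^+ n.+2 * (a - b))%:P =
    a%:P ^+ n.+2 * (b%:P - c%:P) + b%:P ^+ n.+2 * (c%:P - a%:P)
      + c%:P ^+ n.+2 * (a%:P - b%:P).
  have eC u v w : (u ^+ n.+2 * (v - w))%:P = u%:P ^+ n.+2 * (v%:P - w%:P).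
    by rewrite polyCM polyCB polyC_exp.
  by rewrite !polyCD !eC.
rewrite (polyE 0%N) (kernelE (phi := phiX) K0 (g := ev (kp_phase K))).
- by congr diag; apply/funext => n; rewrite polyE.
- rewrite geval_kp_phase; congr diag; apply/funext => -[|k].
    (* At n = 0 the convention that 0 has inverse 0 gives the zero constant term of the phase. *)
    by rewrite invr0 rmorph0 mul0r.
  rewrite xx' /rbracket -!mulrDr polyCM !(polyCD, polyC_exp).
  by [].
- rewrite -!geval_euler -rmorphM; congr (ev _); apply: euler_exp => //.
    by move=> m n; rewrite /= mwtM bidegM.
  exact: kp_phase_mone.
rewrite [LHS]geval_coef1 (@fps_exp_coef _ _ _ 1) ?mdeg1 //.
  by rewrite big_ord1 expr0 fps_coef1 eqxx fact0 invr1 mul1r rmorph1.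
exact: kp_phase_mone.
Qed.

(** The inequality is stable under products and holds for each factor: in the exponential z^k comes
    with t_k or t'_k, of weight k, and in the tau factors w has weight 1. *)
Lemma kp_bilinear_support (m : {cmonom kp_var}) : kp_bilinear tau m != 0 ->
  (m (inr true) + m (inr false) <= mwt kp_weight m true)%N.
Proof.
pose S := [pred m : {cmonom kp_var} |
  (m (inr true) + m (inr false) <= mwt kp_weight m true)%N].
have S1 : S mone by rewrite /= !cm1.
have SM (a b : {cmonom kp_var}) : S a -> S b -> S (mmul a b).
  by move=> Sa Sb; rewrite /= mwtM !cmM addnACA leq_add.
have tS j k : kp_weight j = time_weight k -> supported S (fpsX K j).
  move=> jk b; rewrite fpsXE => /fpsmon_neq0 ->; rewrite /= mwtU jk.
  by rewrite /time_weight expcmnE !cmU muln1; case: j jk => [|[]].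
have wS k : supported S (bracket (kp_w K) k).
  move=> b; rewrite bracket_kp_w => /fpsmon_neq0 ->.
  by rewrite /= mwt_expcmn mwtU !expcmnE !cmU /= !muln1 muln0.
move: m; apply: (@supportedM _ _ S) => //; first apply: supportedM => //.
- apply: supported_exp => //; apply: supported_sum => k m.
  move=> /kp_phase_term[mE m0]; rewrite /= -kp_weight_z m0 addn0.
  by rewrite mE !expcmnE !lzE.
- apply: supported_subst => // k; apply: supportedD; first exact: tS.
  by apply: supportedN; exact: wS.
- apply: supported_subst => // k; apply: supportedD; first exact: tS.
  exact: wS.
Qed.

End Bilinear.

(** * The Fay identity *)

Lemma time_mwt_false m : mwt time_weight m false = 0%N.
Proof. by rewrite mwtE big1 // => k _; rewrite expcmnE cmU !muln0. Qed.

Lemma geval_time_support (K A : comNzRingType) (phi : {rmorphism K -> A})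
    (x : nat -> A) (f : fps nat K) l :
  geval time_grading phi x f l != 0 -> l false = 0%N.
Proof.
move=> fl; apply: contrapT => lf; move/eqP: fl; apply; rewrite /= big1_seq // => m.
by rewrite in_fiber => /andP[_ /eqP ml]; case: lf; rewrite -ml time_mwt_false.
Qed.

(** Pairing the coefficients with a geometric sequence is evaluation at its ratio; with the
    polynomial variable in the place of w, it turns the residue into values at w = a, b, c. *)
Lemma poly_geometric_sum (A : comNzRingType) (g : {poly A}) a B :
  (size g <= B.+1)%N -> \sum_(i < B) a ^+ i.+1 * g`_i.+1 = g.[a] - g`_0.
Proof.
move=> gB; rewrite (horner_coef_wide _ gB) big_ord_recl expr0 mulr1.
by rewrite addrAC subrr add0r; apply: eq_bigr => i _; rewrite mulrC.
Qed.

Section Fay.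
Context (K : fieldType) (A : comNzRingType) (phi : {rmorphism K -> A}).
Hypothesis K0 : forall n, n.+1%:R != 0 :> K.
Context (tau : fps nat K).
Hypothesis tauP : tau_bilinear tau.
Implicit Types (x : nat -> A) (a b c : A).

Definition tev x : fps bool A := geval time_grading phi x tau.

Local Notation br := (rbracket phi).

Section Point.
Context (x x' : nat -> A).
Let phiX : {rmorphism K -> {poly A}} := @polyC A \o phi.

Let G : fps bool {poly A} :=
  geval time_grading phiX (fun k => (x k)%:P + phiX (-1) * rbracket phiX 'X k) tau
  * geval time_grading phiX (fun k => (x' k)%:P + phiX 1 * rbracket phiX 'X k) tau.

Let G_horner a l : (G l).[a] =
  (tev (fun k => x k - br a k) * tev (fun k => x' k + br a k)) l.
Proof.
rewrite -[LHS]/(horner_eval a (G l)).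
have h (r : K) : (phiX r).[a] = phi r by rewrite /= hornerC.
have hb k : (rbracket phiX 'X k).[a] = br a k.
  by rewrite /rbracket hornerM h hornerXn.
apply: rmorph_fps_coefM => {}l.
  rewrite (geval_rmorph (h := horner_eval a) _ _ _ _ h).
  congr (geval _ _ _ _ _); apply/funext => k; rewrite /= horner_evalE.
  by rewrite hornerD hornerM h hb hornerC rmorphN1 mulN1r.
rewrite (geval_rmorph (h := horner_eval a) _ _ _ _ h).
congr (geval _ _ _ _ _); apply/funext => k; rewrite /= horner_evalE.
by rewrite hornerD hornerM h hb hornerC rmorph1 mul1r.
Qed.

Let G_support l : G l != 0 -> l false = 0%N.
Proof.
move=> /fps_coefM_neq0[a [b [<- /geval_time_support fa /geval_time_support fb]]].
by rewrite cmM fa fb.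
Qed.

Let kp_bilinear_eval : geval kp_grading phiX (kp_point x x') (kp_bilinear tau) =
  geval kp_grading phiX (kp_point x x') (fps_exp (kp_phase K)) * G.
Proof.
have u1 : (fun k => fpsX K (inl (inl k) : kp_var) + -1 *: bracket (kp_w K) k) =
    kp_t K - bracket (kp_w K) by apply/funext => k; rewrite scaleN1r.
have u2 : (fun k => fpsX K (inl (inr k) : kp_var) + 1 *: bracket (kp_w K) k) =
    kp_t' K + bracket (kp_w K) by apply/funext => k; rewrite scale1r.
have := geval_tau_shift phi tau x x' (v := fun k => inl (inl k)) (-1).
move=> /(_ (fun=> erefl)); rewrite u1 => e1.
have := geval_tau_shift phi tau x x' (v := fun k => inl (inr k)) 1.
move=> /(_ (fun=> erefl)); rewrite u2 => e2.
rewrite /kp_bilinear -mulrA gevalM gevalM.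
exact: (f_equal2 *%R erefl (f_equal2 *%R e1 e2)).
Qed.

(** The Vandermonde determinant times the residue pairs the coefficients of [G], a polynomial in w
    at each weight, with three geometric sequences. This gives the values of [G] at a, b and c. *)
Lemma bilinear_three_points a b c :
  (forall k, x k - x' k = br a k + br b k + br c k) ->
  let p a := tev (fun k => x k - br a k) * tev (fun k => x' k + br a k) in
  fpsC bool (a * (b - c)) * p a + fpsC bool (b * (c - a)) * p b
    + fpsC bool (c * (a - b)) * p c = 0.
Proof.
move=> xx' p; apply/fpsP => l.
rewrite !fps_coefD !fpsC_mul !fps_coefZ -!G_horner fps_coef0.
have [->|/G_support lf] := eqVneq (G l) 0; first by rewrite !horner0 !mulr0 !addr0.
have -> : l = expcmn lam (l true).
  by apply/eqP/cmP => -[]; rewrite expcmnE cmU ?muln1 ?muln0.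
case: (l true) => [|N].
  (* The residue sees only positive weights. In weight 0 the three products have the same value, and
     a(b-c) + b(c-a) + c(a-b) = 0. *)
  by rewrite expcmn0 !G_horner !coef1M !geval_coef1; ring.
(* [B] has to exceed [N] for the residue to be complete, and to reach the degree of [g] for the
   evaluation. *)
set g := G _; pose B := maxn N.+1 (size g).
pose H i := a ^+ i.+2 * (b - c) + b ^+ i.+2 * (c - a) + c ^+ i.+2 * (a - b).
pose V := H 0%N.
have res : \sum_(i < B) H i * g`_i.+1 = 0.
  transitivity (V * \sum_(i < B) (geval kp_grading phiX (kp_point x x')
      (kp_bilinear tau) (residue_weight N i))`_i.+1); last first.
    rewrite geval_residue_sum ?mulr0 //; last exact: leq_maxl.
    exact: kp_bilinear_support.
  rewrite mulr_sumr; apply: eq_bigr => i _.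
  rewrite -!coefCM; congr (_`_ _).
  transitivity ((fpsC bool V%:P * geval kp_grading phiX (kp_point x x')
      (kp_bilinear tau)) (residue_weight N i)); last by rewrite fpsC_mul.
  rewrite kp_bilinear_eval mulrA (geval_kp_exp K0 xx').
  (* The exponential contributes only powers of [lz], and [G] has no [zet]. The degree in [zet] thus
     forces the i-th power of [lz] and leaves [N.+1] letters [lam] to [G]. *)
  have -> : residue_weight N i = mmul (expcmn lz i) (expcmn lam N.+1).
    apply/eqP/cmP => j; rewrite !cmM !expcmnE !cmU lzE.
    by case: j; rewrite ?muln0 ?muln1 ?addn0 ?add0n // addnC addSnnS.
  rewrite fps_coefM_uniq => [|u v uv].
    by rewrite /diag /= !expcmnE !lzE eqxx muln1.
  rewrite /diag /=; case: (u true =P u false) => [utf _|]; last by rewrite eqxx.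
  move=> /G_support vf; have uf : u false = i.
    move/eqP/cmP: uv => /(_ false); rewrite !cmM vf !expcmnE lzE cmU.
    by rewrite !addn0 muln1 muln0 addn0.
  by apply/eqP/cmP => -[]; rewrite expcmnE lzE muln1 -?uf.
have gB : (size g <= B.+1)%N by rewrite (leq_trans (leq_maxr N.+1 _)).
(* The evaluations also involve the constant coefficient of [g]; its total factor a(b-c) + b(c-a) +
   c(a-b) vanishes. *)
transitivity (\sum_(i < B) H i * g`_i.+1
    + (a * (b - c) + b * (c - a) + c * (a - b)) * g`_0); last first.
  by rewrite res add0r; ring.
rewrite (eq_bigr (fun i : 'I_B => a * (b - c) * (a ^+ i.+1 * g`_i.+1)
   + b * (c - a) * (b ^+ i.+1 * g`_i.+1) + c * (a - b) * (c ^+ i.+1 * g`_i.+1))).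
  by rewrite !big_split /= -!mulr_sumr !poly_geometric_sum //; ring.
by move=> i _; rewrite /H !(exprS _ i.+1); ring.
Qed.

End Point.

(** Take t' = x and t = x + [a] + [b] + [c]: then t - [a] is x + [b] + [c], and cyclically. *)
Lemma fay (x : nat -> A) a b c :
  let T1 a := tev (fun k => x k + br a k) in
  let T2 a b := tev (fun k => x k + br a k + br b k) in
  fpsC bool (a * (b - c)) * (T2 b c * T1 a)
  + fpsC bool (b * (c - a)) * (T2 c a * T1 b)
  + fpsC bool (c * (a - b)) * (T2 a b * T1 c) = 0.
Proof.
move=> T1 T2; pose y k := x k + (br a k + br b k + br c k).
have ea : tev (fun k => y k - br a k) = T2 b c.
  by congr tev; apply/funext => k; rewrite /y; ring.
have eb : tev (fun k => y k - br b k) = T2 c a.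
  by congr tev; apply/funext => k; rewrite /y; ring.
have ec : tev (fun k => y k - br c k) = T2 a b.
  by congr tev; apply/funext => k; rewrite /y; ring.
rewrite -ea -eb -ec; apply: bilinear_three_points.
by move=> k; rewrite /y addrAC subrr add0r.
Qed.

End Fay.

(** * The identity at every weight *)

Section OddTimes.
Context (K : fieldType) (K0 : forall n, n.+1%:R != 0 :> K).
Context (tau : fps nat K).
Hypothesis tau_even : forall k, fps_deriv k.*2.+1 tau = 0.

(** An odd index [k] is that of the even time t_(k+1). The vanishing derivative has the coefficient
    times the exponent, which [K0] allows to cancel. *)
Lemma coef_even_time (m : {cmonom nat}) k : odd k -> m k != 0%N -> tau m = 0.
Proof.
move=> ok mk; have kE : k = (k./2).*2.+1 by rewrite -[LHS]odd_double_half ok.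
have mE : m = mmul (divcm m (ucm k)) (ucm k).
  apply/eqP/cmP => i; rewrite cmM divcmE cmU subnK //.
  by case: (k =P i) => [<-|//]; rewrite lt0n.
have := congr1 (fun f : fps nat K => f (divcm m (ucm k))) (tau_even k./2).
rewrite -kE /= -mE => /eqP.
by rewrite -mulr_natr mulf_eq0 (negbTE (K0 _)) orbF => /eqP.
Qed.

Lemma tev_even_time (A : comNzRingType) (phi : {rmorphism K -> A})
    (x y : nat -> A) :
  (forall k, ~~ odd k -> x k = y k) -> tev phi tau x = tev phi tau y.
Proof.
move=> xy; apply/fpsP => l; apply: eq_bigr => m _.
have [->|tm] := eqVneq (tau m) 0; first by rewrite rmorph0 !mul0r.
congr (_ * _); apply: eq_big_seq => k; rewrite -cmE_neq0 => mk.
by rewrite xy //; apply: contra_neqN tm => ok; exact: coef_even_time ok mk.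
Qed.

(** At an even index the time is odd and so is the power of [a]. Combined with [tev_even_time], this
    gives tau(x + [-a]) = tau(x - [a]). *)
Lemma rbracket_opp (A : comNzRingType) (phi : {rmorphism K -> A}) (a : A) k :
  ~~ odd k -> rbracket phi (- a) k = - rbracket phi a k.
Proof.
move=> ek; rewrite /rbracket exprNn -signr_odd /= ek expr1 mulN1r mulrN.
by [].
Qed.

End OddTimes.

(* T i, S i, TT i j and SS i j stand for tau(t + [z_i]), tau(t - [z_i]),
   tau(t + [z_i] + [z_j]) and tau(t - [z_i] - [z_j]).  The sum of the two Fay
   identities with the weights T1 T2 T3 and - S1 S2 S3 is a cocycle identity for
   the brackets T_i T_j SS_ij - S_i S_j TT_ij; two cocycle identities, for the
   triples 123 and 134, add up to the claim. *)
Lemma four_points_of_fay (B : comNzRingType) (z1 z2 z3 z4 : B)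
    (T1 T2 T3 T4 S1 S2 S3 S4 : B)
    (TT12 TT13 TT14 TT23 TT34 SS12 SS13 SS14 SS23 SS34 : B) :
  z1 * (z2 - z3) * (TT23 * T1) + z2 * (z3 - z1) * (TT13 * T2)
    + z3 * (z1 - z2) * (TT12 * T3) = 0 ->
  z1 * (z2 - z3) * (SS23 * S1) + z2 * (z3 - z1) * (SS13 * S2)
    + z3 * (z1 - z2) * (SS12 * S3) = 0 ->
  z1 * (z3 - z4) * (TT34 * T1) + z3 * (z4 - z1) * (TT14 * T3)
    + z4 * (z1 - z3) * (TT13 * T4) = 0 ->
  z1 * (z3 - z4) * (SS34 * S1) + z3 * (z4 - z1) * (SS14 * S3)
    + z4 * (z1 - z3) * (SS13 * S4) = 0 ->
  z1 * z2 * (z3 - z4) * (T1 * S1 * T2 * S2) * (T3 * T4 * SS34 - S3 * S4 * TT34)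
  + z3 * z4 * (z1 - z2) * (T3 * S3 * T4 * S4) * (T1 * T2 * SS12 - S1 * S2 * TT12)
  = z1 * z4 * (z3 - z2) * (T1 * S1 * T4 * S4) * (T2 * T3 * SS23 - S2 * S3 * TT23)
  + z2 * z3 * (z1 - z4) * (T2 * S2 * T3 * S3) * (T1 * T4 * SS14 - S1 * S4 * TT14).
Proof.
move=> f123 g123 f134 g134; apply/eqP; rewrite -subr_eq0; apply/eqP.
transitivity (
  z4 * (T4 * S4) * (T1 * T2 * T3 *
      (z1 * (z2 - z3) * (SS23 * S1) + z2 * (z3 - z1) * (SS13 * S2)
       + z3 * (z1 - z2) * (SS12 * S3))
    - S1 * S2 * S3 *
      (z1 * (z2 - z3) * (TT23 * T1) + z2 * (z3 - z1) * (TT13 * T2)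
       + z3 * (z1 - z2) * (TT12 * T3)))
  + z2 * (T2 * S2) * (T1 * T3 * T4 *
      (z1 * (z3 - z4) * (SS34 * S1) + z3 * (z4 - z1) * (SS14 * S3)
       + z4 * (z1 - z3) * (SS13 * S4))
    - S1 * S3 * S4 *
      (z1 * (z3 - z4) * (TT34 * T1) + z3 * (z4 - z1) * (TT14 * T3)
       + z4 * (z1 - z3) * (TT13 * T4)))); first by ring.
by rewrite f123 g123 f134 g134 !mulr0 !subr0 !mulr0 addr0.
Qed.

Section GradedIdentity.
Context (K : fieldType) (A : comNzRingType) (phi : {rmorphism K -> A}).
Hypothesis K0 : forall n, n.+1%:R != 0 :> K.
Context (tau : fps nat K) (tau_KdV : is_KdV_tau tau).
Context (x : nat -> A).

Local Notation br := (rbracket phi).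
Local Notation ev := (tev phi tau).
Local Notation k := (@fpsC bool A).

Let tau_even i : fps_deriv i.*2.+1 tau = 0. Proof. by case: tau_KdV. Qed.

Let TT a b := ev (x + br a + br b).
Let SS a b := ev (x - br a - br b).

Let TTC a b : TT a b = TT b a. Proof. by rewrite /TT addrAC. Qed.
Let SSC a b : SS a b = SS b a. Proof. by rewrite /SS addrAC. Qed.

Let fay_plus a b c :
  k a * (k b - k c) * (TT b c * ev (x + br a))
  + k b * (k c - k a) * (TT a c * ev (x + br b))
  + k c * (k a - k b) * (TT a b * ev (x + br c)) = 0.
Proof.
rewrite (TTC a c) -!rmorphB -!rmorphM; apply: (fay phi K0).
by case: tau_KdV => -[].
Qed.

Let fay_minus a b c :
  k a * (k b - k c) * (SS b c * ev (x - br a))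
  + k b * (k c - k a) * (SS a c * ev (x - br b))
  + k c * (k a - k b) * (SS a b * ev (x - br c)) = 0.
Proof.
have evN u : ev (fun i => x i + br (- u) i) = ev (x - br u).
  by apply: (tev_even_time K0 tau_even) => i /(rbracket_opp phi u) ->.
have ev2N u v : ev (fun i => x i + br (- u) i + br (- v) i) = SS u v.
  apply: (tev_even_time K0 tau_even) => i oi.
  by rewrite !(rbracket_opp phi _ oi).
rewrite (SSC a c) -!evN -!ev2N -!rmorphB -!rmorphM.
have cN u v w : u * (v - w) = - u * (- v - - w) :> A by ring.
rewrite (cN a) (cN b) (cN c); apply: (fay phi K0).
by case: tau_KdV => -[].
Qed.

Lemma graded_identity z1 z2 z3 z4 :
  k (z1 * z2 * (z3 - z4)) * quad ev x (br z1) (br z2)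
    * cubic ev x (br z3) (br z4)
  + k (z3 * z4 * (z1 - z2)) * quad ev x (br z3) (br z4)
    * cubic ev x (br z1) (br z2)
  = k (z1 * z4 * (z3 - z2)) * quad ev x (br z1) (br z4)
    * cubic ev x (br z2) (br z3)
  + k (z2 * z3 * (z1 - z4)) * quad ev x (br z2) (br z3)
    * cubic ev x (br z1) (br z4).
Proof.
rewrite !rmorphM !rmorphB.
exact: (four_points_of_fay (fay_plus z1 z2 z3) (fay_minus z1 z2 z3)
  (fay_plus z1 z3 z4) (fay_minus z1 z3 z4)).
Qed.

End GradedIdentity.

(** * The formal identity *)

Section Universal.
Context (J L : choiceType) (K : comNzRingType) (w : grading J L).

(* Evaluation at the generic point of weight w, with values in K[[J]][[L]]:
   the coefficients of ueval f are the homogeneous components of f. *)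
Definition ueval : fps J K -> fps L (fps J K) :=
  geval w (@fpsC J K) (@fpsX J K).

Lemma ueval_coef f l m : ueval f l m = if mwt w m == l then f m else 0.
Proof.
rewrite fps_coef_sum.
under eq_bigr do rewrite fpsC_mul fps_coefZ mon_eval_fpsX /=.
under eq_bigr do rewrite (fun_if ( *%R _)) mulr1 mulr0.
by rewrite (sum_if_eq m (fun a => f a)) ?fset_uniq // in_fiber.
Qed.

Lemma ueval_inj : injective ueval.
Proof.
move=> f g fg; apply/fpsP => m.
have := congr1 (fun h : fps L (fps J K) => h (mwt w m) m) fg.
by rewrite !ueval_coef eqxx.
Qed.

Lemma ueval_hom f l : supported (fun m => mwt w m == l) f ->
  ueval f = fpsmon l f.
Proof.
move=> fl; apply/fpsP => l'; apply/fpsP => m; rewrite ueval_coef /=.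
have [fm|/fl/eqP ml] := eqVneq (f m) 0.
  by case: ifP => _; case: ifP => _; rewrite ?fm.
by rewrite ml eq_sym; case: ifP.
Qed.

End Universal.

Definition tz_weight (j : tz_var) : {cmonom bool} :=
  match j with inl k => time_weight k | inr _ => lam end.

Lemma tz_weight_gt0 j : (0 < mdeg (tz_weight j))%N.
Proof. by case: j => [k|i]; rewrite /tz_weight ?mdegU ?time_weight_gt0. Qed.

Lemma tz_weight_finite n :
  finite_set [set j | (mdeg (tz_weight j) <= n)%N]%classic.
Proof.
pose D := [set k | (mdeg (time_weight k) <= n)%N]%classic.
have finD : finite_set D by exact: time_weight_finite.
apply: (@sub_finite_set _ _ ((inl : nat -> tz_var) @` D
  `|` (inr : 'I_4 -> tz_var) @` setT)%classic).
  by move=> [k|i] /= kn; [left; exists k | right; exists i].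
by rewrite finite_setU; split; apply: finite_image => //; exact: finite_finset.
Qed.

Definition tz_grading := Grading tz_weight_gt0 tz_weight_finite.

Section Morphism.
Context (V : zmodType) (A B : comNzRingType) (h : {rmorphism A -> B}).
Context (ev : V -> A) (ev' : V -> B) (t a b : V).
Hypothesis hev : forall s, shifts t a b s -> h (ev s) = ev' s.

Lemma rmorph_quad : h (quad ev t a b) = quad ev' t a b.
Proof. by rewrite !rmorphM !hev //; rewrite /shifts /=; tauto. Qed.

Lemma rmorph_cubic : h (cubic ev t a b) = cubic ev' t a b.
Proof. by rewrite rmorphB !rmorphM !hev //; rewrite /shifts /=; tauto. Qed.

End Morphism.

Lemma rmorph_cubic_weight (A B : comNzRingType) (h c : {rmorphism A -> B})
    (u : B) (x y z w : A) :
  h x = u * c x -> h y = u * c y -> h z = u * c z -> h w = u * c w ->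
  h (x * y * (z - w)) = u ^+ 3 * c (x * y * (z - w)).
Proof.
by move=> hx hy hz hw; rewrite !rmorphM !rmorphB hx hy hz hw; ring.
Qed.

(** With [h] the generic graded evaluation and [c] the constants, the four prefactors are
    homogeneous of the same degree. They differ from constants by one common factor [u], and
    injectivity of [h] brings the graded identity back to series. *)
Lemma rmorph_four_terms (A B : comNzRingType) (h c : {rmorphism A -> B}) (u : B)
    (w1 w2 w3 w4 q1 q2 q3 q4 k1 k2 k3 k4 : A)
    (q1' q2' q3' q4' k1' k2' k3' k4' : B) :
  injective h ->
  h w1 = u * c w1 -> h w2 = u * c w2 -> h w3 = u * c w3 -> h w4 = u * c w4 ->
  h q1 = q1' -> h q2 = q2' -> h q3 = q3' -> h q4 = q4' ->
  h k1 = k1' -> h k2 = k2' -> h k3 = k3' -> h k4 = k4' ->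
  c w1 * q1' * k1' + c w2 * q2' * k2' = c w3 * q3' * k3' + c w4 * q4' * k4' ->
  w1 * q1 * k1 + w2 * q2 * k2 = w3 * q3 * k3 + w4 * q4 * k4.
Proof.
move=> hI hw1 hw2 hw3 hw4 <- <- <- <- <- <- <- <- e; apply: hI.
by rewrite !rmorphD !rmorphM hw1 hw2 hw3 hw4 -!(mulrA u) -!mulrDr e.
Qed.

Section Formal.
Context (K : fieldType).
Hypothesis K0 : forall n, n.+1%:R != 0 :> K.
Context (tau : fps nat K) (tau_KdV : is_KdV_tau tau).

Local Notation A := (fps tz_var K).
Local Notation Phi := (@ueval tz_var bool K tz_grading).
Local Notation phi := (@fpsC tz_var K).
Local Notation ev := (fps_subst tau).

(** Homogeneity of the weights of the times, under which substitution into tau becomes the graded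
    evaluation [tev]. *)
Definition time_hom (u : nat -> A) :=
  forall k, supported (fun m => mwt tz_grading m == time_weight k) (u k).

Lemma time_hom_t : time_hom (tz_t K).
Proof.
by move=> k m; rewrite /tz_t fpsXE => /fpsmon_neq0 ->; rewrite mwtU.
Qed.

Lemma time_hom_bracket i : time_hom (bracket (tz_z K i)).
Proof.
move=> k m; rewrite /bracket /tz_z fpsXE fpsmonX fpsmonZ => /fpsmon_neq0 ->.
by rewrite mwt_expcmn mwtU.
Qed.

Lemma time_homD u v : time_hom u -> time_hom v -> time_hom (u + v).
Proof. by move=> uP vP k; apply: supportedD. Qed.

Lemma time_homN u : time_hom u -> time_hom (- u).
Proof. by move=> uP k; apply: supportedN. Qed.

Lemma ueval_subst u : time_hom u -> Phi (ev u) = tev phi tau u.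
Proof.
move=> uP; apply: geval_subst => [k m /uP/eqP //|k].
by apply: ueval_hom; exact: uP.
Qed.

Lemma ueval_shifts t a b s : time_hom t -> time_hom a -> time_hom b ->
  shifts t a b s -> Phi (ev s) = tev phi tau s.
Proof.
move=> ht ha hb.
by move=> [[[[[]|]|]|]|] ->; apply: ueval_subst; do ?[apply: time_homD
  | apply: time_homN].
Qed.

Lemma bracketE (z : A) : bracket z = rbracket phi z.
Proof. by apply/funext => k; rewrite /rbracket fpsC_mul. Qed.

Lemma ueval_weight3 i j k l :
  Phi (tz_z K i * tz_z K j * (tz_z K k - tz_z K l)) =
  fpsmon lam 1 ^+ 3
    * fpsC bool (tz_z K i * tz_z K j * (tz_z K k - tz_z K l)).
Proof.
have zE n : Phi (tz_z K n) = fpsmon lam 1 * fpsC bool (tz_z K n).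
  rewrite (@ueval_hom _ _ _ _ _ lam) ?fpsCE ?fpsmonM ?mulm1 ?mul1r // => m.
  by rewrite /tz_z fpsXE => /fpsmon_neq0 ->; rewrite mwtU.
by apply: rmorph_cubic_weight; exact: zE.
Qed.

Lemma formal_identity :
  let t := tz_t K in
  let z1 := tz_z K 0 in let z2 := tz_z K 1 in
  let z3 := tz_z K 2 in let z4 := tz_z K 3 in
  z1 * z2 * (z3 - z4) * quad ev t (bracket z1) (bracket z2)
    * cubic ev t (bracket z3) (bracket z4)
  + z3 * z4 * (z1 - z2) * quad ev t (bracket z3) (bracket z4)
    * cubic ev t (bracket z1) (bracket z2)
  = z1 * z4 * (z3 - z2) * quad ev t (bracket z1) (bracket z4)
    * cubic ev t (bracket z2) (bracket z3)
  + z2 * z3 * (z1 - z4) * quad ev t (bracket z2) (bracket z3)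
    * cubic ev t (bracket z1) (bracket z4).
Proof.
move=> t z1 z2 z3 z4.
have qE a b a' b' : time_hom a -> time_hom b -> a = a' -> b = b' ->
    Phi (quad ev t a b) = quad (tev phi tau) t a' b'.
  move=> ha hb <- <-; apply: rmorph_quad => s; apply: ueval_shifts => //.
  exact: time_hom_t.
have cE a b a' b' : time_hom a -> time_hom b -> a = a' -> b = b' ->
    Phi (cubic ev t a b) = cubic (tev phi tau) t a' b'.
  move=> ha hb <- <-; apply: rmorph_cubic => s; apply: ueval_shifts => //.
  exact: time_hom_t.
have hz := time_hom_bracket; have bE i := bracketE (tz_z K i).
have gid := @graded_identity _ _ phi K0 tau tau_KdV t z1 z2 z3 z4.
exact: (rmorph_four_terms (@ueval_inj _ _ _ tz_grading)
  (ueval_weight3 _ _ _ _) (ueval_weight3 _ _ _ _)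
  (ueval_weight3 _ _ _ _) (ueval_weight3 _ _ _ _)
  (qE _ _ _ _ (hz _) (hz _) (bE _) (bE _))
  (qE _ _ _ _ (hz _) (hz _) (bE _) (bE _))
  (qE _ _ _ _ (hz _) (hz _) (bE _) (bE _))
  (qE _ _ _ _ (hz _) (hz _) (bE _) (bE _))
  (cE _ _ _ _ (hz _) (hz _) (bE _) (bE _))
  (cE _ _ _ _ (hz _) (hz _) (bE _) (bE _))
  (cE _ _ _ _ (hz _) (hz _) (bE _) (bE _))
  (cE _ _ _ _ (hz _) (hz _) (bE _) (bE _)) gid).
Qed.

End Formal.

(** * Absolutely summable coefficients *)

Section AbsoluteSums.
Context (L : choiceType) (C : numFieldType).
Implicit Types (y : fps L C) (B D : {fset {cmonom L}}) (r : seq ({cmonom L} * C)).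

Definition l1_le y M := forall B, \sum_(l <- B) `|y l| <= M.

Definition fps_of_seq r : fps L C := \sum_(p <- r) fpsmon p.1 p.2.

(* The coefficients of y are absolutely summable, with sum v: the finite sums
   that approximate y for the l^1 norm have values close to v. *)
Definition has_sum y v := forall e, 0 < e ->
  exists r, l1_le (y - fps_of_seq r) e /\ `|\sum_(p <- r) p.2 - v| <= e.

Lemma l1_le_ge0 y M : l1_le y M -> 0 <= M.
Proof. by move=> /(_ fset0); rewrite big_seq_fset0. Qed.

Lemma l1_leW y M N : M <= N -> l1_le y M -> l1_le y N.
Proof. by move=> MN yM B; apply: le_trans MN. Qed.

Lemma l1_leD y z M N : l1_le y M -> l1_le z N -> l1_le (y + z) (M + N).
Proof.
move=> yM zN B; apply: le_trans (lerD (yM B) (zN B)).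
by rewrite -big_split; apply: ler_sum => l _; exact: ler_normD.
Qed.

Lemma l1_leN y M : l1_le y M -> l1_le (- y) M.
Proof.
by move=> yM B; under eq_bigr do rewrite fps_coefN normrN; exact: yM.
Qed.

(** All factorisations of elements of [B] use factors from one finite set [D], so the sum is
    dominated by the product of two sums over [D]. *)
Lemma l1_leM y z M N : l1_le y M -> l1_le z N -> l1_le (y * z) (M * N).
Proof.
move=> yM zN B.
have [D BD] : exists D, forall l, l \in B -> forall a b, mmul a b = l ->
    (a \in D) && (b \in D).
  exists (\bigcup_(l <- B) mdivisors l)%fset => l lB a b /mdivisors_factors.
  by move=> /andP[al bl]; apply/andP; split; apply/bigfcupP; exists l;
    rewrite ?lB.
apply: (@le_trans _ _ (\sum_(l <- B) \sum_(a <- D) \sum_(b <- D)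
    if mmul a b == l then `|y a| * `|z b| else 0)).
  rewrite big_seq [leRHS]big_seq; apply: ler_sum => l lB.
  rewrite (fps_coefM y z (BD l lB)) (le_trans (ler_norm_sum _ _ _)) //.
  apply: ler_sum => a _; rewrite (le_trans (ler_norm_sum _ _ _)) //.
  by apply: ler_sum => b _; case: eqP; rewrite ?normr0 // normrM.
rewrite exchange_big; apply: (@le_trans _ _ (\sum_(a <- D) \sum_(b <- D)
    `|y a| * `|z b|)); last first.
  under eq_bigr do rewrite -mulr_sumr; rewrite -mulr_suml.
  by apply: ler_pM => //; rewrite sumr_ge0.
apply: ler_sum => a _; rewrite exchange_big; apply: ler_sum => b _ /=.
rewrite (sum_if_eq _ (fun=> `|y a| * `|z b|)) ?fset_uniq //.
by case: ifP => // _; rewrite mulr_ge0.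
Qed.

Lemma l1_le_fpsmon m c : l1_le (fpsmon m c) `|c|.
Proof.
move=> B /=; under eq_bigr do rewrite (fun_if Num.norm) normr0 eq_sym.
by rewrite (sum_if_eq _ (fun=> `|c|)) ?fset_uniq //; case: ifP.
Qed.

Lemma l1_le_fps_of_seq r : l1_le (fps_of_seq r) (\sum_(p <- r) `|p.2|).
Proof.
elim/big_rec2: (fps_of_seq r) => [B|p N z _ zN].
  by rewrite big1 // => l _; rewrite normr0.
by apply: l1_leD => //; exact: l1_le_fpsmon.
Qed.

Lemma fps_of_seqD r r' : fps_of_seq (r ++ r') = fps_of_seq r + fps_of_seq r'.
Proof. exact: big_cat. Qed.

Lemma has_sum_l1 y v : has_sum y v -> exists M, l1_le y M.
Proof.
move=> /(_ 1 ltr01)[r [yr _]]; exists (1 + \sum_(p <- r) `|p.2|).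
by rewrite -(subrK (fps_of_seq r) y); apply/l1_leD/l1_le_fps_of_seq.
Qed.

Lemma sum_fps_of_seq r B : (forall p, p \in r -> p.1 \in B) ->
  \sum_(p <- r) p.2 = \sum_(l <- B) fps_of_seq r l.
Proof.
move=> rB; under [RHS]eq_bigr do rewrite fps_coef_sum.
rewrite exchange_big; apply: eq_big_seq => p pr /=.
under eq_bigr do rewrite eq_sym.
by rewrite (sum_if_eq _ (fun=> p.2)) ?fset_uniq // rB.
Qed.

Lemma norm_le_eq0 (x : C) : (forall e, 0 < e -> `|x| <= e) -> x = 0.
Proof.
move=> xe; apply/eqP; rewrite -normr_eq0; apply: contraT => x0.
have x_gt0 : 0 < `|x| by rewrite lt_neqAle eq_sym x0 normr_ge0.
have := xe _ (divr_gt0 x_gt0 (ltr0n _ 2)).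
by rewrite ler_pdivlMr // ger_pMr // lern1.
Qed.

(** Two finite approximations are close in the l^1 norm, and the difference of their totals is
    bounded by that norm over a finite set containing both supports. *)
Lemma has_sum_unique y v v' : has_sum y v -> has_sum y v' -> v = v'.
Proof.
move=> yv yv'; apply/eqP; rewrite -subr_eq0; apply/eqP; apply: norm_le_eq0 => e e0.
have e4 : 0 < e / 4%:R by rewrite divr_gt0 // ltr0n.
have [r [yr rv]] := yv _ e4; have [r' [yr' rv']] := yv' _ e4.
pose B := [fset l | l in map fst (r ++ r')]%fset.
have rB p : p \in r -> p.1 \in B.
  by move=> pr; rewrite inE; apply: map_f; rewrite mem_cat pr.
have r'B p : p \in r' -> p.1 \in B.
  by move=> pr; rewrite inE; apply: map_f; rewrite mem_cat pr orbT.
pose s := \sum_(p <- r) p.2; pose s' := \sum_(p <- r') p.2.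
have ss' : `|s - s'| <= e / 4%:R + e / 4%:R.
  rewrite /s /s' (sum_fps_of_seq rB) (sum_fps_of_seq r'B) -sumrB.
  apply: le_trans (ler_norm_sum _ _ _) _.
  have := l1_leD (l1_leN yr) yr'; rewrite opprB addrA subrK.
  by move=> /(_ B).
have -> : v - v' = (s - s') + ((v - s) + (s' - v')) by ring.
have eE : e = (e / 4%:R + e / 4%:R) + (e / 4%:R + e / 4%:R).
  by field.
rewrite [leRHS]eE; apply: le_trans (ler_normD _ _) (lerD ss' _).
by apply: le_trans (ler_normD _ _) (lerD _ _) => //; rewrite distrC.
Qed.

Lemma has_sumD y z v u : has_sum y v -> has_sum z u -> has_sum (y + z) (v + u).
Proof.
move=> yv zu e e0; have e2 : 0 < e / 2%:R by rewrite divr_gt0 // ltr0n.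
have [r [yr rv]] := yv _ e2; have [q [zq qu]] := zu _ e2.
exists (r ++ q); rewrite fps_of_seqD big_cat !opprD (addrACA y) (addrACA _ _ (- v)).
have eE : e = e / 2%:R + e / 2%:R by field.
rewrite eE; split; first exact: l1_leD.
exact: le_trans (ler_normD _ _) (lerD rv qu).
Qed.

Lemma has_sumN y v : has_sum y v -> has_sum (- y) (- v).
Proof.
move=> yv e /yv[r [yr rv]]; exists [seq (p.1, - p.2) | p <- r].
rewrite /fps_of_seq !big_map /=; split.
  under eq_bigr do rewrite fpsmonN.
  by rewrite sumrN -opprD; exact: l1_leN.
by rewrite sumrN -opprD normrN.
Qed.

Lemma has_sumC c : has_sum (fpsC L c) c.
Proof.
move=> e e0; exists [:: (mone, c)]; rewrite /fps_of_seq !big_seq1 fpsCE !subrr.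
rewrite normr0; split; last exact: ltW.
by move=> B; rewrite big1 ?ltW // => l _; rewrite fps_coef0 normr0.
Qed.

Lemma has_sumM y z v u : has_sum y v -> has_sum z u -> has_sum (y * z) (v * u).
Proof.
move=> yv zu e e0.
have [M yM] := has_sum_l1 yv; have [N zN] := has_sum_l1 zu.
have M0 := l1_le_ge0 yM; have N0 := l1_le_ge0 zN.
(* With d = e/(S+e) one has d <= 1 and dS <= e. The l^1 error and the error on the value both have
   the form dX + (Y+d)d with X + Y + 1 <= S. *)
pose S := M + N + `|v| + `|u| + 1.
have S1 : 1 <= S by rewrite lerDr !addr_ge0.
have S0 : 0 < S := lt_le_trans ltr01 S1.
have eS0 : 0 < S + e by rewrite addr_gt0.
pose d := e / (S + e).
have d0 : 0 < d by rewrite divr_gt0.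
have d1 : d <= 1 by rewrite ler_pdivrMr // mul1r lerDr ltW.
have dS : d * S <= e.
  by rewrite mulrAC ler_pdivrMr // ler_wpM2l ?lerDl ?ltW.
have [r [yr rv]] := yv _ d0; have [q [zq qu]] := zu _ d0.
exists [seq (mmul a.1 b.1, a.2 * b.2) | a <- r, b <- q].
have dE X Y : 0 <= X -> 0 <= Y -> X + Y + 1 <= S -> d * X + (Y + d) * d <= e.
  move=> X0 Y0 XYS; apply: le_trans dS; rewrite mulrC -mulrDl mulrC.
  by apply: ler_wpM2l; [exact: ltW|apply: le_trans XYS; rewrite -addrA !lerD].
split.
  have -> : fps_of_seq [seq (mmul a.1 b.1, a.2 * b.2) | a <- r, b <- q] =
      fps_of_seq r * fps_of_seq q.
    rewrite /fps_of_seq big_allpairs_dep mulr_suml; apply: eq_bigr => a _ /=.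
    by rewrite mulr_sumr; apply: eq_bigr => b _; rewrite fpsmonM.
  have -> : y * z - fps_of_seq r * fps_of_seq q =
      (y - fps_of_seq r) * z
        + (y - (y - fps_of_seq r)) * (z - fps_of_seq q) by ring.
  apply: l1_leW (l1_leD (l1_leM yr zN) (l1_leM (l1_leD yM (l1_leN yr)) zq)).
  by apply: dE; rewrite // /S (addrC N) lerD2r -addrA lerDl addr_ge0.
rewrite big_allpairs_dep /=; under eq_bigr do rewrite -mulr_sumr.
rewrite -mulr_suml; set s := \sum_(p <- r) p.2; set t := \sum_(p <- q) p.2.
have -> : s * t - v * u = (s - v) * u + (v + (s - v)) * (t - u) by ring.
apply: le_trans (ler_normD _ _) _; rewrite !normrM.
apply: (@le_trans _ _ (d * `|u| + (`|v| + d) * d)).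
  apply: lerD; first exact: ler_wpM2r.
  by apply: ler_pM => //; apply: le_trans (ler_normD _ _) (lerD _ _).
apply: dE => //; rewrite /S lerD2r (addrC `|u|) lerD2r.
by rewrite lerDr addr_ge0.
Qed.

End AbsoluteSums.

(** * From unconditional to absolute convergence *)

Section AbsoluteConvergence.
Context (T : choiceType) (C : numClosedFieldType) (x : T -> C).
Context (A : {fset T}) (e : C).
Hypothesis small : forall B : {fset T}, [disjoint A & B]%fset ->
  `|\sum_(i <- B) x i| <= e.

Let small_filter (B : {fset T}) (P : pred T) : [disjoint A & B]%fset ->
  `|\sum_(i <- B | P i) x i| <= e.
Proof.
move=> AB; rewrite big_fset_condE; apply: small.
apply/fdisjointP => i /(fdisjointP AB); apply: contra.
by rewrite !inE => /andP[].
Qed.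

Let small_real (f : {additive C -> C}) (B : {fset T}) :
  (forall z, f z \is Num.real) -> (forall z, `|f z| <= `|z|) ->
  [disjoint A & B]%fset -> \sum_(i <- B) `|f (x i)| <= e + e.
Proof.
move=> f_real f_le AB; rewrite (bigID (fun i => 0 <= f (x i))) /=.
have bound P : `|\sum_(i <- B | P i) f (x i)| <= e.
  by rewrite -raddf_sum (le_trans (f_le _)) // small_filter.
apply: lerD.
  apply: le_trans (bound (fun i => 0 <= f (x i))).
  rewrite ger0_norm; last exact: sumr_ge0.
  by apply: ler_sum => i f0; rewrite ger0_norm.
apply: le_trans (bound (fun i => ~~ (0 <= f (x i)))).
rewrite -normrN -sumrN ger0_norm; last first.
  apply: sumr_ge0 => i; rewrite -real_ltNge ?real0 // => /ltW.
  by rewrite oppr_ge0.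
apply: ler_sum => i; rewrite -real_ltNge ?real0 // => fi.
by rewrite ltr0_norm.
Qed.

(** Real and imaginary parts are split by sign; each of the four pieces is bounded by one partial
    sum, hence by [e]. *)
Lemma abs_small (B : {fset T}) : [disjoint A & B]%fset ->
  \sum_(i <- B) `|x i| <= (e + e) + (e + e).
Proof.
move=> AB; apply: (@le_trans _ _ (\sum_(i <- B) (`|'Re (x i)| + `|'Im (x i)|))).
  apply: ler_sum => i _; rewrite {1}[x i]Crect (le_trans (ler_normD _ _)) //.
  by rewrite normrM normCi mul1r.
rewrite big_split; apply: lerD; apply: small_real => // z.
- exact: Creal_Re.
- by have [] := leif_normC_Re_Creal z.
- exact: Creal_Im.
rewrite -normrN -ReMil (le_trans (leif_normC_Re_Creal _).1) //.
by rewrite normrM normCi mul1r.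
Qed.

End AbsoluteConvergence.

(** * The numerical identity *)

(** Unconditional convergence makes the terms outside a finite set [A] absolutely small; grouping
    them by weight can only decrease the l^1 norm. *)
Lemma has_sum_tev (C : numClosedFieldType) (tau : fps nat C) (s : nat -> C) v :
  fps_converges tau s v -> has_sum (tev (@idfun C) tau s) v.
Proof.
(* Sums disjoint from [A] are differences of two approximations, hence at most 2d, and [abs_small]
   multiplies this by 4. *)
move=> cv e e0; pose d := e / 8%:R.
have d0 : 0 < d by rewrite divr_gt0 // ltr0n.
have eE : e = ((d + d) + (d + d)) + ((d + d) + (d + d)) by rewrite /d; field.
have [A AP] := cv d d0; pose x m := tau m * mon_eval s m.
have small (B : {fset {cmonom nat}}) : [disjoint A & B]%fset ->
    `|\sum_(m <- B) x m| <= d + d.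
  move=> AB; have -> : \sum_(m <- B) x m =
      (\sum_(m <- (A `|` B)%fset) x m - v) - (\sum_(m <- A) x m - v).
    have -> : \sum_(m <- (A `|` B)%fset) x m =
        \sum_(m <- A) x m + \sum_(m <- B) x m; last by ring.
      rewrite -big_cat; apply: perm_big; apply: uniq_perm => [||m].
      - exact: fset_uniq.
      - rewrite cat_uniq !fset_uniq andbT /=; apply/hasPn => m mB.
        by apply: contraL mB; exact/fdisjointP.
      - by rewrite in_fsetU mem_cat.
  apply: le_trans (ler_normB _ _) (lerD _ _); apply: ltW; apply: AP => //.
  exact: fsubsetUl.
(* The approximation puts each term of [A] at its weight; what remains at each weight is the sum
   over monomials outside [A]. *)
exists [seq (mwt time_grading m, x m) | m <- A]; split; last first.
  rewrite big_map; apply: ltW; apply: lt_trans (AP A _) _ => //.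
  by rewrite /d ltr_pdivrMr ?ltr0n // ltr_pMr // ltr1n.
have coefE l : (tev idfun tau s
      - fps_of_seq [seq (mwt time_grading m, x m) | m <- A]) l =
    \sum_(m <- fiber time_grading l | m \notin A) x m.
  rewrite fps_coefD fps_coefN /fps_of_seq big_map fps_coef_sum /=.
  rewrite (bigID (fun m => m \in A)) /= addrAC -[RHS]add0r; congr (_ + _).
  apply/eqP; rewrite subr_eq0; apply/eqP; under [RHS]eq_bigr do rewrite eq_sym.
  rewrite -[RHS]big_mkcond -[LHS]big_filter -[RHS]big_filter; apply: perm_big.
  apply: uniq_perm; rewrite ?filter_uniq ?fset_uniq // => m.
  by rewrite !mem_filter in_fiber andbC.
move=> B; under eq_bigr do rewrite coefE.
apply: (@le_trans _ _ (\sum_(m <- fibers time_grading B | m \notin A) `|x m|)).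
  rewrite [leRHS]big_mkcond sum_fibers; apply: ler_sum => l _.
  by rewrite -big_mkcond; exact: ler_norm_sum.
rewrite big_fset_condE eE; apply: (abs_small small).
by apply/fdisjointP => m mA; rewrite !inE mA andbF.
Qed.

Section Numeric.
Context (V : zmodType) (L : choiceType) (C : numFieldType).
Context (ev : V -> fps L C) (f : V -> C) (t a b : V).
Hypothesis evf : forall s, shifts t a b s -> has_sum (ev s) (f s).

Lemma has_sum_quad : has_sum (quad ev t a b) (quad f t a b).
Proof. by do ?apply: has_sumM; apply: evf; rewrite /shifts /=; tauto. Qed.

Lemma has_sum_cubic : has_sum (cubic ev t a b) (cubic f t a b).
Proof.
apply: has_sumD; last apply: has_sumN;
  by do ?apply: has_sumM; apply: evf; rewrite /shifts /=; tauto.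
Qed.

End Numeric.

(** Both sides of the graded identity are the same series in the weight parameter; summing it in two
    ways gives the two numerical sides, equal by [has_sum_unique]. *)
Lemma numeric_identity (C : numClosedFieldType) (tau : fps nat C)
    (tau_KdV : is_KdV_tau tau) (D : set (nat -> C)) (f : (nat -> C) -> C) :
  (forall s, D s -> fps_converges tau s (f s)) ->
  forall (t : nat -> C) (z1 z2 z3 z4 : C),
  let br := rbracket (@idfun C) in
  (shifts t (br z1) (br z2) `<=` D)%classic ->
  (shifts t (br z3) (br z4) `<=` D)%classic ->
  (shifts t (br z2) (br z3) `<=` D)%classic ->
  (shifts t (br z1) (br z4) `<=` D)%classic ->
  z1 * z2 * (z3 - z4) * quad f t (br z1) (br z2) * cubic f t (br z3) (br z4)
  + z3 * z4 * (z1 - z2) * quad f t (br z3) (br z4) * cubic f t (br z1) (br z2)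
  = z1 * z4 * (z3 - z2) * quad f t (br z1) (br z4) * cubic f t (br z2) (br z3)
  + z2 * z3 * (z1 - z4) * quad f t (br z2) (br z3) * cubic f t (br z1) (br z4).
Proof.
move=> cv t z1 z2 z3 z4 br D12 D34 D23 D14.
have K0 n : n.+1%:R != 0 :> C by rewrite pnatr_eq0.
have hs a b : (shifts t a b `<=` D)%classic -> forall s, shifts t a b s ->
    has_sum (tev (@idfun C) tau s) (f s).
  by move=> abD s /abD /cv; exact: has_sum_tev.
have gid := @graded_identity _ _ (@idfun C) K0 tau tau_KdV t z1 z2 z3 z4.
have hq a b (H : (shifts t a b `<=` D)%classic) := has_sum_quad (hs a b H).
have hc a b (H : (shifts t a b `<=` D)%classic) := has_sum_cubic (hs a b H).
have hterm (c : C) q u v k : has_sum q v -> has_sum k u ->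
    has_sum (fpsC bool c * q * k) (c * v * u).
  by move=> qv ku; exact: has_sumM (has_sumM (has_sumC _ _) qv) ku.
have lhs := has_sumD
  (hterm (z1 * z2 * (z3 - z4)) _ _ _ _ (hq _ _ D12) (hc _ _ D34))
  (hterm (z3 * z4 * (z1 - z2)) _ _ _ _ (hq _ _ D34) (hc _ _ D12)).
have rhs := has_sumD
  (hterm (z1 * z4 * (z3 - z2)) _ _ _ _ (hq _ _ D14) (hc _ _ D23))
  (hterm (z2 * z3 * (z1 - z4)) _ _ _ _ (hq _ _ D23) (hc _ _ D14)).
by rewrite gid in lhs; exact: has_sum_unique lhs rhs.
Qed.

(** Multiplication by z1 z2 z3 z4 turns z4^-1 - z3^-1 into z1 z2 (z3 - z4), and likewise for the
    other prefactors. *)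
Lemma four_terms_inverses (F : fieldType) (z1 z2 z3 z4 X1 X2 X3 X4 : F)
    (Y1 Y2 Y3 Y4 : F) :
  z1 != 0 -> z2 != 0 -> z3 != 0 -> z4 != 0 ->
  z1 * z2 * (z3 - z4) * X1 * Y1 + z3 * z4 * (z1 - z2) * X2 * Y2 =
  z1 * z4 * (z3 - z2) * X3 * Y3 + z2 * z3 * (z1 - z4) * X4 * Y4 ->
  (z4^-1 - z3^-1) * X1 * Y1 + (z2^-1 - z1^-1) * X2 * Y2 =
  (z2^-1 - z3^-1) * X3 * Y3 + (z4^-1 - z1^-1) * X4 * Y4.
Proof.
move=> z1N0 z2N0 z3N0 z4N0 e.
have P0 : z1 * z2 * z3 * z4 != 0 by rewrite !mulf_neq0.
apply: (mulfI P0).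
transitivity (z1 * z2 * (z3 - z4) * X1 * Y1 + z3 * z4 * (z1 - z2) * X2 * Y2).
  by field; rewrite z1N0 z2N0 z3N0 z4N0.
by rewrite e; field; rewrite z1N0 z2N0 z3N0 z4N0.
Qed.

Theorem mainTheorem3 (R : realType) (tau : fps nat R[i]) (tau_KdV : is_KdV_tau tau) :
  (* as formal power series in t, z1, z2, z3, z4, multiplied by z1 z2 z3 z4 *)
  (let ev := fps_subst tau in
   let t := tz_t R[i] in
   let z1 := tz_z R[i] 0 in let z2 := tz_z R[i] 1 in
   let z3 := tz_z R[i] 2 in let z4 := tz_z R[i] 3 in
   z1 * z2 * (z3 - z4) * quad ev t (bracket z1) (bracket z2)
     * cubic ev t (bracket z3) (bracket z4)
   + z3 * z4 * (z1 - z2) * quad ev t (bracket z3) (bracket z4)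
     * cubic ev t (bracket z1) (bracket z2)
   = z1 * z4 * (z3 - z2) * quad ev t (bracket z1) (bracket z4)
     * cubic ev t (bracket z2) (bracket z3)
   + z2 * z3 * (z1 - z4) * quad ev t (bracket z2) (bracket z3)
     * cubic ev t (bracket z1) (bracket z4))
  /\
  (* as complex numbers, for a function f represented on D by the series tau *)
  (forall (D : set (nat -> R[i])) (f : (nat -> R[i]) -> R[i]),
     (forall s, D s -> fps_converges tau s (f s)) ->
   forall (t : nat -> R[i]) (z1 z2 z3 z4 : R[i]^o),
     z1 != 0 -> z2 != 0 -> z3 != 0 -> z4 != 0 ->
     (shifts t (bracket z1) (bracket z2) `<=` D)%classic ->
     (shifts t (bracket z3) (bracket z4) `<=` D)%classic ->
     (shifts t (bracket z2) (bracket z3) `<=` D)%classic ->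
     (shifts t (bracket z1) (bracket z4) `<=` D)%classic ->
   (z4^-1 - z3^-1) * quad f t (bracket z1) (bracket z2)
     * cubic f t (bracket z3) (bracket z4)
   + (z2^-1 - z1^-1) * quad f t (bracket z3) (bracket z4)
     * cubic f t (bracket z1) (bracket z2)
   = (z2^-1 - z3^-1) * quad f t (bracket z1) (bracket z4)
     * cubic f t (bracket z2) (bracket z3)
   + (z4^-1 - z1^-1) * quad f t (bracket z2) (bracket z3)
     * cubic f t (bracket z1) (bracket z4)).
Proof.
have K0 n : n.+1%:R != 0 :> R[i] by rewrite pnatr_eq0.
split; first exact: (@formal_identity R[i] K0 tau tau_KdV).
move=> D f cv t z1 z2 z3 z4 z1N0 z2N0 z3N0 z4N0 D12 D34 D23 D14.
(* Over [R[i]^o] scaling is multiplication, so [bracket] and [rbracket] for the identity morphism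
   agree by conversion. *)
exact: (@four_terms_inverses R[i] z1 z2 z3 z4 _ _ _ _ _ _ _ _ z1N0 z2N0 z3N0
  z4N0 (@numeric_identity R[i] tau tau_KdV D f cv t z1 z2 z3 z4 D12 D34 D23 D14)).
Qed.
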